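(* Let $F=\{f_1,\ldots,f_M\}$ and assume that there are constants $\kappa_0>0$ and $\beta_0>0$ for which $$P\bigl(|f(X)|\ge \kappa_0\|f\|_{L_2}\bigr)\ge \beta_0\qquad\text{for every } f\in\operatorname{span}(F).$$ Let $N\ge (400)^2M/\beta_0^2$ and set $\zeta=Y-f^*(X)$. Assume further that one of the following two conditions holds: 1. $\zeta$ is independent of $X$ and $\mathbb{E}\zeta^2\le\sigma^2$, or 2. $|\zeta|\le\sigma$ almost surely. Then, for every $x>0$, with probability at least $1-\exp(-\beta_0^2N/4)-(1/x)$, $$\|\hat f-f^*\|_{L_2}^2=R(\hat f)-\min_{f\in\operatorname{span}(F)}R(f)\le\left(\frac{16}{\beta_0\kappa_0^2}\right)^2\frac{\sigma^2Mx}{N},$$ where $\hat f\in\operatorname{arg\,min}_{f\in\operatorname{span}(F)}R_N(f)$ is the empirical risk minimizer.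
   Context: $(\mathcal{X},\mu)$ is a probability space, $X$ is a random variable with values in $\mathcal{X}$ distributed according to $\mu$, and $Y$ is a real-valued random variable (the target) with $\mathbb{E}Y^2<\infty$. $(X_i,Y_i)_{i=1}^N$ are $N$ independent copies of $(X,Y)$; ''with probability'' refers to this sample. $F=\{f_1,\ldots,f_M\}$ is a finite set (dictionary) of real-valued measurable functions on $\mathcal{X}$ with $\mathbb{E}f_j(X)^2<\infty$, and $\operatorname{span}(F)=\{\sum_{j=1}^M t_jf_j : t\in\mathbb{R}^M\}$. $\|f\|_{L_2}=(\mathbb{E}f(X)^2)^{1/2}$. The risk of a (deterministic) $f$ is $R(f)=\mathbb{E}(Y-f(X))^2$; for a sample-dependent $\hat f$, $R(\hat f)=\mathbb{E}\bigl((Y-\hat f(X))^2\mid (X_i,Y_i)_{i=1}^N\bigr)$ with $(X,Y)$ independent of the sample, and likewise $\|\hat f-f^*\|_{L_2}^2=\mathbb{E}\bigl((\hat f(X)-f^*(X))^2\mid (X_i,Y_i)_{i=1}^N\bigr)$. The oracle $f^*\in\operatorname{span}(F)$ is a function with $R(f^* )=\inf_{f\in\operatorname{span}(F)}R(f)$. The empirical risk is $R_N(f)=\frac1N\sum_{i=1}^N(Y_i-f(X_i))^2$. *)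

(* Defs.v *)
From HB Require Import structures.
From mathcomp Require Import all_boot all_order all_algebra.
From mathcomp Require Import all_classical all_reals all_analysis.

Set Implicit Arguments.
Unset Strict Implicit.
Unset Printing Implicit Defensive.
Import Order.TTheory GRing.Theory Num.Theory.
Local Open Scope classical_set_scope.
Local Open Scope ring_scope.

Definition lin_span (R : realType) (U : Type) (M : nat)
    (f : 'I_M -> U -> R) : set (U -> R) :=
  [set h | exists t : 'I_M -> R, h = (fun u => \sum_(j < M) t j * f j u)].

(* Real-valued: [fine] loses nothing on square-integrable functions, the only
   ones to which the norm and the risk are applied below. *)
Definition L2norm d (T : measurableType d) (R : realType)
    (P : probability T R) (U : Type) (X : T -> U) (h : U -> R) : R :=
  Num.sqrt (fine 'E_P[fun w => h (X w) ^+ 2]).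

(* For a data-dependent estimator [fhat], the risk conditional on the sample is
   [risk P X Y (fhat w)]: the expectation runs over a fresh pair (X, Y),
   independent of the sample, while the sample point [w] is frozen.
   [L2norm P X] is used in the same way. *)
Definition risk d (T : measurableType d) (R : realType)
    (P : probability T R) (U : Type) (X : T -> U) (Y : T -> R)
    (h : U -> R) : R :=
  fine 'E_P[fun w => (Y w - h (X w)) ^+ 2].

Definition emp_risk (T : Type) (R : realType) (U : Type) (N : nat)
    (Xs : 'I_N -> T -> U) (Ys : 'I_N -> T -> R) (w : T) (h : U -> R) : R :=
  N%:R^-1 * \sum_(i < N) (Ys i w - h (Xs i w)) ^+ 2.

Definition is_argmin (U : Type) (R : realType) (S : set U) (r : U -> R)
    (u : U) : Prop :=
  S u /\ forall v, S v -> r u <= r v.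

Definition independent2 d (T : measurableType d) (R : realType)
    (P : probability T R) d1 (U1 : measurableType d1)
    d2 (U2 : measurableType d2) (V1 : T -> U1) (V2 : T -> U2) : Prop :=
  forall (A : set U1) (B : set U2), measurable A -> measurable B ->
    P (V1 @^-1` A `&` V2 @^-1` B) = (P (V1 @^-1` A) * P (V2 @^-1` B))%E.

Definition mutually_independent d (T : measurableType d) (R : realType)
    (P : probability T R) d' (U : measurableType d') (N : nat)
    (Z : 'I_N -> T -> U) : Prop :=
  forall (J : {set 'I_N}) (B : 'I_N -> set U), (forall i, measurable (B i)) ->
    P (\bigcap_(i in [set` J]) (Z i @^-1` B i))
    = (\prod_(i in J) P (Z i @^-1` B i))%E.

Definition same_distribution d (T : measurableType d) (R : realType)
    (P : probability T R) d' (U : measurableType d') (Z Z' : T -> U) : Prop :=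
  forall B : set U, measurable B -> P (Z @^-1` B) = P (Z' @^-1` B).

Definition iid_copies d (T : measurableType d) (R : realType)
    (P : probability T R) d' (U : measurableType d') (N : nat)
    (Zs : 'I_N -> T -> U) (Z : T -> U) : Prop :=
  mutually_independent P Zs /\ forall i, same_distribution P (Zs i) Z.

(* An inner-probability bound: no measurability of E is required, and it reads
   [p <= P E] when E is measurable. *)
Definition with_prob_ge d (T : measurableType d) (R : realType)
    (P : probability T R) (p : R) (E : set T) : Prop :=
  exists A : set T, [/\ measurable A, A `<=` E & (p%:E <= P A)%E].

(* Main.v *)
Require Import Defs.
From HB Require Import structures.
From mathcomp Require Import all_boot all_order all_algebra.
From mathcomp Require Import all_classical all_reals all_analysis.
From mathcomp Require Import measurable_realfun zify ring lra.

Set Implicit Arguments.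
Unset Strict Implicit.
Unset Printing Implicit Defensive.
Import Order.TTheory GRing.Theory Num.Theory.
Local Open Scope classical_set_scope.
Local Open Scope ring_scope.

(** Let [e_1, ..., e_m] be an orthonormal basis in L2 of the span of the dictionary
    ([gram_schmidt]), and write the error [h = fhat - fstar] as
    [\sum_k t_k e_k], so that its squared norm is [|t|^2]. Let [zeta_i] be the
    residuals of the oracle on the sample, and [W] the vector of the averages
    [W_k] of [zeta_i * e_k (X_i)]. Since [fhat] does at least as well as [fstar]
    on the sample, the average of [h (X_i) ^ 2] is at most [2 <t, W>].

    The noise. The oracle is a projection, so [zeta] is orthogonal to the span
    ([residual_orthogonal]) and each [W_k] is a centred average of independent
    variables; either assumption on the noise gives [E (zeta * e_k (X)) ^ 2 <=
    sigma ^ 2] ([noise_moment]). Hence [E |W|^2 <= sigma ^ 2 M / N]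
    ([iid_mean_square]), and Markov's inequality costs the probability [1 / x].

    The quadratic form. Outside an event of probability
    [exp (- beta0 ^ 2 N / 4)], every [t != 0] satisfies
    [|<t, e (X_i)>| >= kappa0 |t|] for at least [beta0 N / 8] of the indices
    ([uniform_small_ball]). For one [t] this is a Chernoff bound. For all [t] at
    once, suppose that [t] violates it and let [J] be the set of the indices at
    which the inequality fails. After scaling, [t] lies in the polytope
    [|<s, e (X_i)>| <= 1], [i] in [J], and its norm exceeds [1 / kappa0]. The
    norm is convex, so some vertex of the polytope is at least as long, and thus
    violates the bound as well; but a vertex solves a linear system given by [m]
    of the points, with right-hand sides 1 and -1 ([candidate_vertex]). When the
    polytope contains a line, a direction orthogonal to the points plays the same
    role, at the cost of a few coordinate equations ([candidate_kernel]). So it is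
    enough to control finitely many candidates. Each of them is a function of at
    most [m] of the sample points, hence independent of the other ones, and the
    Chernoff bound holds for it ([frozen_chernoff]). There are at most
    [(100 / beta0) ^ m * exp (3 beta0 (N + m) / 100)] candidates
    ([small_support_count]), which the sample size makes negligible against
    the Chernoff bound ([union_bound_exponent]).

    Together, [(beta0 / 8) kappa0 ^ 2 |t|^2 <= 2 <t, W> <= 2 |t| |W|], that is
    [|t| <= 16 / (beta0 kappa0 ^ 2) * |W|] ([erm_dot_bound]). *)

(** * Small-ball violations are witnessed at vertices *)

Section VertexCandidates.
Context {R : realFieldType} {m : nat}.
Implicit Types (t u v : 'cV[R]_m).

Definition dot u v : R := \sum_(k < m) u k 0 * v k 0.

Lemma dotDl u v t : dot (u + v) t = dot u t + dot v t.
Proof.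
by rewrite /dot -big_split/=; apply: eq_bigr => k _; rewrite mxE mulrDl.
Qed.

Lemma dotZl (a : R) u v : dot (a *: u) v = a * dot u v.
Proof.
by rewrite /dot mulr_sumr; apply: eq_bigr => k _; rewrite mxE mulrA.
Qed.

Lemma dotC u v : dot u v = dot v u.
Proof. by apply: eq_bigr => k _; rewrite mulrC. Qed.

Lemma dot_ge0 u : 0 <= dot u u.
Proof. by apply: sumr_ge0 => k _; rewrite -expr2 sqr_ge0. Qed.

Lemma dot_eq0 u : dot u u = 0 -> u = 0.
Proof.
move=> uu0; apply/colP => k; rewrite mxE.
apply/eqP; rewrite -sqrf_eq0; apply/eqP.
move/eqP: uu0; rewrite psumr_eq0 => [/allP/(_ k)|i _]; last first.
  by rewrite -expr2 sqr_ge0.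
by rewrite mem_index_enum -expr2 => /(_ isT)/eqP.
Qed.

Lemma dot_gt0 u : u != 0 -> 0 < dot u u.
Proof.
move=> u0; rewrite lt_neqAle dot_ge0 andbT eq_sym.
by apply: contra_neq u0 => /dot_eq0.
Qed.

Lemma dot_delta u k : dot u (delta_mx k 0) = u k 0.
Proof.
rewrite /dot (bigD1 k)//= mxE !eqxx mulr1 big1 ?addr0// => i ik.
by rewrite mxE (negbTE ik) mulr0.
Qed.

Section SpanningSets.
Context {I : finType} (p : I -> 'cV[R]_m).
Implicit Types (S : {set I}) (y : I -> R).

(** Spanning is phrased dually, through orthogonality: extremal choices of a
    vector yield it in this form, and the normal equations use it so. *)
Definition spans S := forall u, (forall i, i \in S -> dot u (p i) = 0) -> u = 0.

(** In a minimal spanning set every point is the only one seen by some vector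
    orthogonal to the others; these vectors against the points form an
    invertible diagonal matrix that factors through dimension [m]. *)
Lemma spans_small S0 : spans S0 ->
  exists S, [/\ S \subset S0, spans S & (#|S| <= m)%N].
Proof.
move=> sp0.
have [] := @minset_exists _ (fun S => `[< spans S >]) S0.
  by apply/asboolP.
move=> S /minsetP[/asboolP sp minS] SS0; exists S; split => //.
have /choice[U PU] (i : 'I_#|S|) : exists u,
    (forall j, j != i -> dot u (p (enum_val j)) = 0) /\
    dot u (p (enum_val i)) != 0.
  apply: contrapT => /forallNP nu.
  have spi : spans (S :\ enum_val i).
    move=> u u0; apply: sp => j jS.
    have [->|ji] := eqVneq j (enum_val i); last by apply: u0; rewrite !inE ji.
    apply: contrapT => /eqP ui; apply: (nu u); split => // k ki.
    by apply: u0; rewrite !inE (inj_eq enum_val_inj) ki enum_valP.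
  have := minS (S :\ enum_val i) (asboolT spi) (subD1set _ _).
  move=> /setP/(_ (enum_val i)); rewrite !inE eqxx/= => /esym.
  by rewrite enum_valP.
pose B : 'M[R]_(#|S|, m) := \matrix_(i, k) U i k 0.
pose C : 'M[R]_(m, #|S|) := \matrix_(k, j) p (enum_val j) k 0.
have BC : B *m C = diag_mx (\row_i dot (U i) (p (enum_val i))).
  apply/matrixP => i j; rewrite !mxE.
  transitivity (dot (U i) (p (enum_val j))).
    by apply: eq_bigr => k _; rewrite !mxE.
  have [->|ij] := eqVneq i j; first by rewrite mulr1n.
  by rewrite mulr0n; apply: (PU i).1; rewrite eq_sym.
have : B *m C \in unitmx.
  rewrite BC unitmxE det_diag unitfE; apply/prodf_neq0 => i _.
  by rewrite mxE; exact: (PU i).2.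
move=> /mxrank_unit BCr.
by rewrite -[X in (X <= _)%N]BCr (leq_trans (mxrankM_maxl _ _))// rank_leq_col.
Qed.

Definition gram S : 'M[R]_m := \sum_(i in S) p i *m (p i)^T.

(** The solution of [dot t (p i) = y i], [i \in S], through the normal equations,
    but with the adjugate in place of the inverse: it is then a polynomial in
    the coordinates of the points, hence measurable in them. The extra factor
    [\det (gram S)] rescales both sides of a homogeneous inequality alike. *)
Definition normal_sol S y : 'cV[R]_m := \adj (gram S) *m \sum_(i in S) y i *: p i.

Lemma gramM S u : gram S *m u = \sum_(i in S) dot u (p i) *: p i.
Proof.
rewrite mulmx_suml; apply: eq_bigr => i _.
rewrite -mulmxA; apply/colP => k; rewrite !mxE big_ord1 !mxE mulrC.
by congr (_ * _); apply: eq_bigr => j _; rewrite !mxE mulrC.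
Qed.

Lemma normal_solE S y t : spans S -> (forall i, i \in S -> dot t (p i) = y i) ->
  exists2 a, a != 0 & normal_sol S y = a *: t.
Proof.
move=> sp ty; exists (\det (gram S)); last first.
  rewrite /normal_sol (_ : \sum_(i in S) _ = gram S *m t).
    by rewrite mulmxA mul_adj_mx mul_scalar_mx.
  by rewrite gramM; apply: eq_bigr => i iS; rewrite ty.
rewrite -unitfE -[_ \is a _]unitmxE -row_free_unit -kermx_eq0.
apply/eqP/row_matrixP => i; rewrite row0.
pose u := (row i (kermx (gram S)))^T.
suff u0 : u = 0 by rewrite -[LHS]trmxK -/u u0 trmx0.
have gu : gram S *m u = 0.
  have : u^T *m gram S = 0 by rewrite trmxK -row_mul mulmx_ker row0.
  move/(congr1 trmx); rewrite trmx_mul trmxK trmx0 => <-; congr (_ *m _).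
  rewrite /gram raddf_sum; apply: eq_bigr => j _ /=.
  by rewrite trmx_mul trmxK.
apply: sp => j jS; apply/eqP; rewrite -sqrf_eq0; apply/eqP.
have : dot (gram S *m u) u = 0.
  by rewrite gu /dot big1// => k _; rewrite mxE mul0r.
rewrite gramM.
have -> : dot (\sum_(i in S) dot u (p i) *: p i) u =
          \sum_(i in S) dot u (p i) ^+ 2.
  rewrite (big_morph (fun w => dot w u) (fun a b => dotDl a b u)
    (_ : dot 0 u = 0)); last by rewrite /dot big1// => k _; rewrite mxE mul0r.
  by apply: eq_bigr => k _; rewrite dotZl expr2 (dotC (p k)).
move/eqP; rewrite psumr_eq0 => [/allP/(_ j)|k _]; last exact: sqr_ge0.
by rewrite mem_index_enum jS => /(_ isT)/eqP.
Qed.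

End SpanningSets.

Section Candidates.
Context {N : nat}.
Implicit Types (x : 'I_N -> 'cV[R]_m) (J : {set 'I_N}).

(** The coordinate vectors join the data points so that a direction orthogonal
    to too few data points can still be singled out by [m] equations. *)
Definition pool x (i : 'I_N + 'I_m) : 'cV[R]_m :=
  match i with inl i => x i | inr k => delta_mx k 0 end.

(** [None] leaves a point of the pool out of the linear system, and [Some a]
    puts it in with right-hand side [a - 1], one of -1, 0 and 1. *)
Definition config := {ffun 'I_N + 'I_m -> option 'I_3}.

Definition supp (g : config) : {set 'I_N + 'I_m} := [set i | isSome (g i)]%SET.

Definition config_val (g : config) i : R :=
  if g i is Some a then (a : nat)%:R - 1 else 0.

Definition candidate x g : 'cV[R]_m :=
  normal_sol (pool x) (supp g) (config_val g).

Lemma candidateP x S0 t : spans (pool x) S0 ->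
    (forall i, i \in S0 -> dot t (pool x i) \in [:: -1; 0; 1]) ->
  exists g a, [/\ (#|supp g| <= m)%N, a != 0 & candidate x g = a *: t].
Proof.
move=> sp0 tS0; have [S [SS0 sp cS]] := spans_small sp0.
have /choice[v Pv] i : exists a : 'I_3,
    i \in S -> dot t (pool x i) = (a : nat)%:R - 1.
  have [iS|_] := boolP (i \in S); last by exists ord0.
  have := tS0 i (fintype.subsetP SS0 _ iS).
  rewrite !inE => /or3P[]/eqP->.
  - by exists (inord 0); rewrite inordK// => _; rewrite sub0r.
  - by exists (inord 1); rewrite inordK// => _; rewrite subrr.
  - by exists (inord 2); rewrite inordK// => _; rewrite -[2%:R]/(1 + 1 : R) addrK.
pose g : config := [ffun i => if i \in S then Some (v i) else None].
have gS : supp g = S.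
  by apply/setP => i; rewrite inE ffunE; case: ifP.
have [|a a0 ca] := @normal_solE _ (pool x) S (config_val g) t sp.
  by move=> i iS; rewrite /config_val ffunE iS Pv.
exists g, a; split; rewrite ?gS//.
by rewrite /candidate gS.
Qed.

(** Among the vectors orthogonal to the data points of [J], one with as many
    zero coordinates as possible is determined up to a factor by [J], by these
    zeros and by one further coordinate: a second solution could be used to
    cancel another coordinate. *)
Lemma candidate_kernel x J v0 : v0 != 0 ->
    (forall i, i \in J -> dot v0 (x i) = 0) ->
  exists g, [/\ (#|supp g| <= m)%N, candidate x g != 0 &
    forall i, i \in J -> dot (candidate x g) (x i) = 0].
Proof.
move=> v00 v0J.
pose zeros v : {set 'I_m} := [set k | v k 0 == 0]%SET.
pose Q n := `[< exists v, [/\ v != 0, forall i, i \in J -> dot v (x i) = 0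
                         & #|zeros v| = n] >].
have exQ : exists n, Q n by exists #|zeros v0|; apply/asboolP; exists v0.
have Qm n : Q n -> (n <= m)%N.
  by move=> /asboolP[v [_ _ <-]]; rewrite -[leqRHS]card_ord max_card.
case: (ex_maxnP exQ Qm) => n /asboolP[v [vn0 vJ vn]] maxn.
have [k0 vk0] : exists k0, v k0 0 != 0.
  apply: contrapT => /forallNP v0'; move/eqP: vn0; apply.
  by apply/colP => k; rewrite mxE; apply/eqP/negPn/negP/v0'.
pose t := (v k0 0)^-1 *: v.
pose S0 : {set 'I_N + 'I_m} :=
  ([set inl i | i in J] :|: [set inr k | k in k0 |: zeros v])%SET.
have sp0 : spans (pool x) S0.
  move=> u u0; apply: contrapT => /eqP un0.
  have uJ i : i \in J -> dot u (x i) = 0.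
    by move=> iJ; apply: (u0 (inl i)); rewrite inE imset_f.
  have uz k : k \in k0 |: zeros v -> u k 0 = 0.
    move=> kz; rewrite -dot_delta; apply: (u0 (inr k)).
    by rewrite inE imset_f// orbT.
  have [k1 uk1] : exists k1, u k1 0 != 0.
    apply: contrapT => /forallNP v0'; move/eqP: un0; apply.
    by apply/colP => k; rewrite mxE; apply/eqP/negPn/negP/v0'.
  pose w := v + (- (v k1 0 / u k1 0)) *: u.
  have wk0 : w k0 0 = v k0 0.
    by rewrite !mxE (uz k0) ?mulr0 ?addr0// !inE eqxx.
  have wn0 : w != 0.
    by apply: contraNneq vk0 => w0; rewrite -wk0 w0 mxE.
  have Qw : Q #|zeros w|.
    apply/asboolP; exists w; split => // i iJ.
    by rewrite dotDl dotZl vJ// uJ// mulr0 addr0.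
  have := maxn _ Qw; apply/negP; rewrite -ltnNge -vn; apply: proper_card.
  apply/properP; split.
    apply/fintype.subsetP => k; rewrite !inE => /eqP vk.
    by rewrite !mxE vk (uz k) ?mulr0 ?addr0// !inE vk eqxx orbT.
  exists k1; rewrite !inE; first by rewrite !mxE mulNr divfK// subrr.
  by apply: contra uk1 => vk1; rewrite uz// !inE vk1 orbT.
have [|g [a [gm a0 ga]]] := @candidateP x S0 t sp0.
  move=> i; rewrite inE => /orP[|] /imsetP[k kJ ->] /=.
    by rewrite dotZl vJ// mulr0 !inE eqxx orbT.
  rewrite dot_delta mxE; move: kJ; rewrite !inE => /orP[/eqP->|/eqP->].
    by rewrite mulVf// eqxx !orbT.
  by rewrite mulr0 eqxx orbT.
exists g; split => //; rewrite ga.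
  rewrite scaler_eq0 negb_or a0 scaler_eq0 negb_or invr_eq0 vk0.
  by apply: contra vk0 => /eqP->; rewrite mxE.
by move=> i iJ; rewrite !dotZl vJ// !mulr0.
Qed.

(** Scale [t0] so that [dot t0 (x i)] is at most 1 in absolute value over [J] and
    reached. Among the vectors that satisfy these constraints and are long
    enough, one with the most tight constraints is a vertex: along a direction
    orthogonal to the tight points one could move, without loss of norm since
    the squared norm is convex, until another constraint becomes tight. *)
Lemma candidate_vertex x J t0 (b : R) : 0 < b -> spans x J -> t0 != 0 ->
    (forall i, i \in J -> dot t0 (x i) ^+ 2 < b * dot t0 t0) ->
  exists g, [/\ (#|supp g| <= m)%N, candidate x g != 0 &
    forall i, i \in J ->
      dot (candidate x g) (x i) ^+ 2 < b * dot (candidate x g) (candidate x g)].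
Proof.
move=> b0 spJ t00 t0J.
pose feasible t := (forall i, i \in J -> dot t (x i) ^+ 2 <= 1) /\
                   1 < b * dot t t.
pose tight t : {set 'I_N} := [set i in J | dot t (x i) ^+ 2 == 1]%SET.
pose Q n := `[< exists2 t, feasible t & #|tight t| = n >].
have exQ : exists n, Q n.
  have [i0 i0J] : exists i, i \in J.
    apply: contrapT => /forallNP J0; move/eqP: t00; apply.
    by apply: spJ => i /(J0 i).
  have [i1 i1J maxi1] :=
    @arg_maxP _ _ _ i0 (fun i => i \in J) (fun i => `|dot t0 (x i)|) i0J.
  pose a := `|dot t0 (x i1)|.
  have a0 : 0 < a.
    rewrite lt_neqAle normr_ge0 andbT eq_sym; apply: contra_neq t00 => a0.
    apply: spJ => i iJ; apply/eqP; rewrite -normr_le0.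
    by have := maxi1 i iJ; rewrite -/a a0.
  exists #|tight (a^-1 *: t0)|; apply/asboolP; exists (a^-1 *: t0) => //.
  split=> [i iJ|].
    rewrite dotZl exprMn exprVn -[leLHS]mulrC ler_pdivrMr ?exprn_gt0// mul1r.
    by rewrite -real_normK ?num_real// ler_sqr ?nnegrE ?normr_ge0//; exact: maxi1.
  rewrite dotZl dotC dotZl.
  have -> : b * (a^-1 * (a^-1 * dot t0 t0)) = b * dot t0 t0 / a ^+ 2.
    by rewrite expr2 invfM; ring.
  by rewrite ltr_pdivlMr ?exprn_gt0// mul1r real_normK ?num_real//; exact: t0J.
have Qm n : Q n -> (n <= N)%N.
  by move=> /asboolP[t _ <-]; rewrite -[leqRHS]card_ord max_card.
case: (ex_maxnP exQ Qm) => n /asboolP[t [tJ bt] tn] maxn.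
have sp0 : spans x (tight t).
  move=> u ut; apply: contrapT => /eqP un0.
  wlog tu : u ut un0 / 0 <= dot t u.
    move=> wl; have [tu|/ltW tu] := leP 0 (dot t u); first exact: (wl u).
    apply: (wl (- u)); rewrite ?oppr_eq0//.
      by move=> i /ut; rewrite -scaleN1r dotZl => ->; rewrite mulr0.
    by rewrite dotC -scaleN1r dotZl mulN1r oppr_ge0 dotC.
  pose mv := [pred i | (i \in J) && (dot u (x i) != 0)].
  have [i0 mi0] : exists i, mv i.
    apply: contrapT => /forallNP nmv; move/eqP: un0; apply.
    apply: spJ => i iJ; apply/eqP/negPn/negP => ui.
    by apply: (nmv i); rewrite /= iJ.
  (* the time at which the constraint [i] becomes tight along [t + s *: u] *)
  pose s i := (Num.sg (dot u (x i)) - dot t (x i)) / dot u (x i).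
  have [i1 mi1 mins] := @arg_minP _ _ _ i0 mv s mi0.
  have tlt i : mv i -> -1 < dot t (x i) < 1.
    move=> /andP[iJ ui]; rewrite -ltr_norml -(@ltr_pXn2r _ 2)// ?nnegrE//.
    rewrite expr1n real_normK ?num_real// lt_neqAle tJ// andbT.
    by apply: contra ui => ti; rewrite ut// inE iJ.
  have sE i : mv i -> s i * dot u (x i) = Num.sg (dot u (x i)) - dot t (x i).
    by move=> /andP[_ ui]; rewrite /s divfK.
  have s_gt0 i : mv i -> 0 < s i.
    move=> mi; have /andP[iJ ui] := mi; have /andP[t1 t2] := tlt i mi.
    have [u0|u0|u0] := ltgtP (dot u (x i)) 0; last by rewrite u0 eqxx in ui.
      by rewrite /s ltr0_sg// nmulr_rgt0 ?invr_lt0//; lra.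
    by rewrite /s gtr0_sg// divr_gt0//; lra.
  pose t' := t + s i1 *: u.
  have t'E i : dot t' (x i) = dot t (x i) + s i1 * dot u (x i).
    by rewrite dotDl dotZl.
  have ft' : feasible t'.
    split=> [i iJ|].
      have [ui|ui] := eqVneq (dot u (x i)) 0.
        by rewrite t'E ui mulr0 addr0 tJ.
      have mi : mv i by rewrite /= iJ.
      have si := sE i mi; have s1 := mins i mi; have s0 := s_gt0 _ mi1.
      have /andP[t1 t2] := tlt i mi.
      suff /andP[h1 h2] : -1 <= dot t' (x i) <= 1 by nra.
      rewrite t'E; have [u0|u0|u0] := ltgtP (dot u (x i)) 0.
      - rewrite ltr0_sg// in si; have := ler_wnM2r (ltW u0) s1.
        by rewrite si => h; apply/andP; split; nra.
      - rewrite gtr0_sg// in si; have := ler_wpM2r (ltW u0) s1.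
        by rewrite si => h; apply/andP; split; nra.
      - by rewrite u0 eqxx in ui.
    apply: (lt_le_trans bt); rewrite ler_wpM2l ?(ltW b0)//.
    rewrite !(dotDl, dotZl) (dotC t t') (dotC u t') !(dotDl, dotZl) (dotC u t).
    have := s_gt0 _ mi1; have := dot_ge0 u; move: tu => /=; nra.
  have Qt' : Q #|tight t'| by apply/asboolP; exists t'.
  have := maxn _ Qt'; apply/negP; rewrite -ltnNge -tn; apply: proper_card.
  apply/properP; split.
    apply/fintype.subsetP => i ti; have := ti; rewrite !inE => /andP[-> ti1] /=.
    by rewrite t'E ut// mulr0 addr0.
  have /andP[i1J ui1] := mi1.
  exists i1; rewrite !inE i1J/=.
    by rewrite t'E sE// addrC subrK sqr_sg ui1.
  by apply: contra ui1 => ti; rewrite ut// inE i1J.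
have tn0 : t != 0.
  apply: contraTneq bt => ->; rewrite /dot big1 ?mulr0 ?ltr10// => k _.
  by rewrite mxE mul0r.
have [||g [a [gm a0 ga]]] := @candidateP x (inl @: tight t) t.
- move=> u u0; apply: sp0 => i ti; apply: (u0 (inl i)); exact: imset_f.
- move=> i /imsetP[k]; rewrite inE => /andP[_ tk] -> /=.
  by move: tk; rewrite sqrf_eq1 !inE => /orP[/eqP->|/eqP->]; rewrite eqxx ?orbT.
exists g; split => //; rewrite ga; first by rewrite scaler_eq0 negb_or a0.
move=> i iJ; rewrite !dotZl (dotC t (a *: t)) dotZl exprMn.
apply: le_lt_trans (_ : a ^+ 2 < _).
  by rewrite ler_piMr ?sqr_ge0// tJ.
rewrite (_ : b * _ = a ^+ 2 * (b * dot t t)); last by ring.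
rewrite ltr_pMr// lt_neqAle sqr_ge0 andbT eq_sym.
by rewrite sqrf_eq0.
Qed.

(** The polytope cut out by the points of [J] either has a vertex or contains a
    line. *)
Lemma candidate_exists x J t0 (b : R) : 0 < b -> t0 != 0 ->
    (forall i, i \in J -> dot t0 (x i) ^+ 2 < b * dot t0 t0) ->
  exists g, (#|supp g| <= m)%N /\ forall i, i \in J ->
    dot (candidate x g) (x i) ^+ 2 < b * dot (candidate x g) (candidate x g).
Proof.
move=> b0 t00 t0J; have [spJ|] := pselect (spans x J).
  by have [g [gm _ gJ]] := candidate_vertex b0 spJ t00 t0J; exists g.
move=> /existsNP[v /not_implyP[vJ /eqP v0]].
have [g [gm g0 gJ]] := candidate_kernel v0 vJ.
exists g; split => // i iJ; rewrite gJ// expr0n/=.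
by rewrite mulr_gt0// dot_gt0.
Qed.

End Candidates.
End VertexCandidates.

(** * Counting the candidates *)

(** Expanding [\prod_i (1 + #|A| * l)] over all choice functions gives
    [l ^+ k] to each function with [k] chosen points. *)
Lemma small_support_count (R : realFieldType) (I A : finType) (n : nat) (l : R) :
  0 <= l <= 1 ->
  #|[set g : {ffun I -> option A} | (#|[set i | isSome (g i)]%SET| <= n)%N]%SET|%:R
    * l ^+ n <= (1 + #|A|%:R * l) ^+ #|I|.
Proof.
move=> /andP[l0 l1]; pose wt (a : option A) := if a is Some _ then l else 1.
have wtE (g : {ffun I -> option A}) :
    \prod_i wt (g i) = l ^+ #|[set i | isSome (g i)]%SET|.
  rewrite -prodr_const (bigID (mem [set i | isSome (g i)]%SET))/=.
  rewrite [X in _ * X]big1 ?mulr1 => [|i]; last first.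
    by rewrite inE /wt; case: (g i).
  by apply: eq_bigr => i; rewrite inE /wt; case: (g i).
have -> : (1 + #|A|%:R * l) ^+ #|I| = \sum_(g : {ffun I -> option A}) \prod_i wt (g i).
  rewrite -(bigA_distr_bigA (fun=> wt))/= -prodr_const; apply: eq_bigr => i _.
  have -> : \sum_a wt a = \sum_(a <- None :: map Some (enum A)) wt a.
    apply: perm_big; apply: uniq_perm; first exact: index_enum_uniq.
      rewrite /= map_inj_uniq ?enum_uniq ?andbT; last by move=> ? ? [].
      by apply/mapP => -[x _].
    move=> [a|]; rewrite mem_index_enum !inE//=.
    by rewrite mem_map ?mem_enum// => ? ? [].
  by rewrite big_cons big_map big_enum/= sumr_const mulr_natl.
rewrite mulr_natl -sumr_const [leRHS](bigID (mem
  [set g : {ffun I -> option A} | (#|[set i | isSome (g i)]%SET| <= n)%N]%SET))/=.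
rewrite ler_wpDr ?sumr_ge0// => [g _|].
  by rewrite wtE exprn_ge0.
apply: ler_sum => g; rewrite inE => gn.
by rewrite wtE ler_wiXn2l.
Qed.

(** The exponents of the count, with [l = b / 100] and [1 / l <= expR (1 / l)],
    and of the Chernoff bound for one candidate. The sample size makes [s / b]
    at most [b * n / 400 ^+ 2], so only [b * n * (3 / 100 + 1 / 8 - 1 / 2)] and
    tiny terms remain. *)
Lemma union_bound_exponent (R : realType) (b n p s : R) :
  0 < b <= 1 -> 1 <= s <= p -> 400 ^+ 2 * p / b ^+ 2 <= n ->
  (b / 100)^-1 * s + 3 * (b / 100) * (n + s) + (b * n / 8 - b / 2 * (n - s))
  <= - (b ^+ 2 * n / 4).
Proof.
move=> /andP[b0 b1] /andP[s1 sp]; rewrite expr2.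
have b2 : 0 < b ^+ 2 by rewrite exprn_gt0.
rewrite (ler_pdivrMr _ _ b2) => pn.
have k0 : 0 <= 400 * 400 :> R := mulr_ge0 (ler0n _ _) (ler0n _ _).
have n0 : 0 <= n.
  rewrite -(pmulr_lge0 _ b2); apply: le_trans pn; apply: (mulr_ge0 k0).
  by rewrite (le_trans _ (le_trans s1 sp)).
have bnn : b ^+ 2 * n <= b * n.
  by rewrite expr2 -mulrA ler_piMl ?mulr_ge0 ?(ltW b0).
have sn : 400 * (400 * s) <= b ^+ 2 * n.
  by rewrite mulrA [leRHS]mulrC; exact: (le_trans (ler_wpM2l k0 sp) pn).
have h1 : (b / 100)^-1 * s <= b * n / 1600.
  rewrite invf_div mulrAC ler_pdivrMr//; nra.
have h2 : 400 * (400 * s) <= b * n by exact: le_trans bnn.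
have h3 : b * s <= s by rewrite ler_piMl// (le_trans _ s1).
have h4 : 400 * (400 * (b * s)) <= b * n.
  by rewrite mulrA; apply: (le_trans (ler_wpM2l k0 h3)); rewrite -mulrA.
lra.
Qed.

(** * Integration of independent variables *)

Section Independence.
Context d (T : measurableType d) (R : realType) (P : probability T R).
Local Open Scope ereal_scope.

(** Both measures agree on measurable rectangles. *)
Lemma product_law d1 d2 (U1 : measurableType d1) (U2 : measurableType d2)
    (V1 : {mfun T >-> U1}) (V2 : {mfun T >-> U2})
    (V : {mfun T >-> (U1 * U2)%type}) :
  (forall w, V w = (V1 w, V2 w)) -> independent2 P V1 V2 ->
  forall A, measurable A ->
    distribution P V A = (distribution P V1 \x distribution P V2) A.
Proof.
move=> VE ind A mA; apply/esym/product_measure_unique => // B C mB mC.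
rewrite /distribution/= /pushforward -ind//; congr (P _).
by apply/seteqP; split=> w /=; rewrite VE.
Qed.

Lemma ge0_integral_independent2 d1 d2
    (U1 : measurableType d1) (U2 : measurableType d2)
    (V1 : T -> U1) (V2 : T -> U2) (F : U1 * U2 -> \bar R) :
  measurable_fun setT V1 -> measurable_fun setT V2 -> independent2 P V1 V2 ->
  measurable_fun setT F -> (forall z, 0 <= F z) ->
  \int[P]_w F (V1 w, V2 w) = \int[P]_w \int[P]_v F (V1 w, V2 v).
Proof.
move=> mV1 mV2 ind mF F0.
pose W1 : {mfun T >-> U1} := mfun_Sub (mem_set mV1).
pose W2 : {mfun T >-> U2} := mfun_Sub (mem_set mV2).
have mV : measurable_fun setT (fun w => (V1 w, V2 w)).
  exact: measurable_fun_pair.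
pose W : {mfun T >-> (U1 * U2)%type} := mfun_Sub (mem_set mV).
rewrite -[LHS](@ge0_integral_distribution _ _ _ _ _ P W F)//.
rewrite (@eq_measure_integral _ _ _ _
  (distribution P W1 \x distribution P W2)); last first.
  by move=> A mA _; exact: product_law.
rewrite fubini_tonelli1// ge0_integral_distribution//; last 2 first.
- exact: measurable_fun_fubini_tonelli_F.
- by move=> y; exact: integral_ge0.
apply: eq_integral => w _ /=; rewrite /fubini_F.
rewrite (@ge0_integral_distribution _ _ _ _ _ P W2 (fun y => F (V1 w, y)))//.
exact: measurable_fun_pair2.
Qed.

Lemma measurable_integral_section d1 d2
    (U1 : measurableType d1) (U2 : measurableType d2)
    (V2 : T -> U2) (F : U1 * U2 -> \bar R) :
  measurable_fun setT V2 -> measurable_fun setT F -> (forall z, 0 <= F z) ->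
  measurable_fun setT (fun u => \int[P]_v F (u, V2 v)).
Proof.
move=> mV2 mF F0; pose W2 : {mfun T >-> U2} := mfun_Sub (mem_set mV2).
rewrite (_ : (fun _ => _) = fubini_F (distribution P W2) F).
  exact: measurable_fun_fubini_tonelli_F.
apply/funext => u; rewrite /fubini_F.
rewrite (@ge0_integral_distribution _ _ _ _ _ P W2 (fun y => F (u, y)))//.
exact: measurable_fun_pair2.
Qed.

Lemma integral_mul_independent2_eq0 (V1 V2 : T -> R) :
  measurable_fun setT V1 -> measurable_fun setT V2 -> independent2 P V1 V2 ->
  P.-integrable setT (EFin \o V2) ->
  P.-integrable setT (EFin \o (V1 \* V2)%R) -> \int[P]_w (V2 w)%:E = 0 ->
  \int[P]_w (V1 w * V2 w)%:E = 0.
Proof.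
move=> mV1 mV2 ind i2 i12 z2.
pose W1 : {mfun T >-> R} := mfun_Sub (mem_set mV1).
pose W2 : {mfun T >-> R} := mfun_Sub (mem_set mV2).
have mV : measurable_fun setT (fun w => (V1 w, V2 w)).
  exact: measurable_fun_pair.
pose W : {mfun T >-> (R * R)%type} := mfun_Sub (mem_set mV).
pose F (z : R * R) : \bar R := (z.1 * z.2)%:E.
have mF : measurable_fun setT F.
  by apply/measurable_EFinP; apply: measurable_funM.
have lawE := @product_law _ _ _ _ W1 W2 W (fun=> erefl) ind.
rewrite -[LHS](@integral_distribution _ _ _ _ _ P W F)//.
rewrite (@eq_measure_integral _ _ _ _
  (distribution P W1 \x distribution P W2)); last by move=> A mA _; exact: lawE.
rewrite -integral12_prod_meas1; last first.
  apply/integrableP; split => //.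
  rewrite -(@eq_measure_integral _ _ _ _ _ (distribution P W)); last first.
    by move=> A mA _; exact: lawE.
  rewrite ge0_integral_distribution//; last exact: measurableT_comp.
  by have /integrableP[_] := i12.
rewrite integral0_eq// => x _; rewrite /fubini_F /F/=.
under eq_integral do rewrite EFinM.
have mid : measurable_fun setT (fun y : R => y%:E) by exact/measurable_EFinP.
rewrite integralZl//; last exact: (integrable_pushforward (phi := W2)).
rewrite (@integral_distribution _ _ _ _ _ P W2 (fun y : R => y%:E))//.
by rewrite [X in _ * X]z2 mule0.
Qed.

End Independence.

(** * Each variable is independent of the family of the others *)

Section CylinderIndependence.
Context d (T : measurableType d) (R : realType) (P : probability T R).
Local Open Scope ereal_scope.
Context d' (U : measurableType d') {N : nat} (Z : 'I_N -> T -> U).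
Hypothesis mZ : forall i, measurable_fun setT (Z i).

(** A pi-system that generates the sigma-algebra of the variables other than
    [Z j]. Putting that sigma-algebra on [T] itself lets any function of the
    other variables be used as it is, without a product space for them. *)
Definition cylinders (j : 'I_N) : set (set T) :=
  [set D | exists B : 'I_N -> set U, [/\ forall i, measurable (B i), B j = setT &
    D = \bigcap_(i in [set: 'I_N]) (Z i @^-1` B i)]].

Notation T_ j := (g_sigma_algebraType (cylinders j)).

Lemma cylinders_measurable j : cylinders j `<=` measurable.
Proof.
move=> _ [B [mB _ ->]]; apply: fin_bigcap_measurable => // i _.
by rewrite -[X in measurable X]setTI; exact: mZ.
Qed.

Lemma measurable_others j (A : set (T_ j)) : measurable A -> measurable (A : set T).
Proof.
by apply: smallest_sub; [exact: sigma_algebra_measurable|exact: cylinders_measurable].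
Qed.

Lemma measurable_id_others j : measurable_fun setT (id : T -> T_ j).
Proof. by move=> _ A mA; rewrite setTI; exact: (@measurable_others j A). Qed.

Lemma measurable_coord_others i j : i != j -> measurable_fun setT (Z i : T_ j -> U).
Proof.
move=> ij _ A mA; apply: sub_sigma_algebra.
exists (fun k => if k == i then A else setT); split.
- by move=> k; case: ifP.
- by rewrite eq_sym (negbTE ij).
- apply/seteqP; split=> w /=.
    by move=> [_ Aw] k _; case: eqP => [->|].
  by move=> /(_ i I); rewrite /= eqxx.
Qed.

(** For fixed [B], the two sides are finite measures in the first set that agree
    on the cylinders. *)
Lemma independent2_others j :
  mutually_independent P Z -> independent2 P (id : T -> T_ j) (Z j).
Proof.
move=> ind A B mA mB; rewrite preimage_id.
have mZB : measurable (Z j @^-1` B) by rewrite -[X in measurable X]setTI; exact: mZ.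
pose m1 := mrestr P mZB.
have PB0 : (0 <= fine (P (Z j @^-1` B)))%R by rewrite fine_ge0.
pose m2 := mscale (NngNum PB0) P.
have indT (C : 'I_N -> set U) : (forall i, measurable (C i)) ->
    P (\bigcap_(i in [set: 'I_N]) (Z i @^-1` C i)) = (\prod_i P (Z i @^-1` C i))%E.
  move=> mC; rewrite (_ : [set: 'I_N] = [set` [set: 'I_N]%SET]).
    by rewrite ind//; apply: eq_bigl => i; rewrite inE.
  by apply/seteqP; split => i //= _; rewrite inE.
have m2E D : m2 D = P D * P (Z j @^-1` B).
  rewrite muleC; congr (_ * _).
  by apply: fineK; exact: fin_num_measure.
suff -> : P (A `&` Z j @^-1` B) = m2 A.
  exact: m2E.
apply: (g_sigma_algebra_measure_unique (cylinders j) _ (fun=> setT) _ _ m1 m2) => //.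
- exact: cylinders_measurable.
- move=> _; exists (fun=> setT); split => //.
  by apply/seteqP; split.
- by rewrite bigcup_const.
- move=> _ _ [B1 [mB1 B1j ->]] [B2 [mB2 B2j ->]].
  exists (fun i => B1 i `&` B2 i); split.
  + by move=> i; exact: measurableI.
  + by rewrite B1j B2j setTI.
  + by rewrite -bigcapI; apply: eq_bigcapr => i _; rewrite preimage_setI.
- move=> _ [C [mC Cj ->]].
  apply: etrans (esym (m2E _)); rewrite /m1 /= /mrestr.
  pose C' i := if i == j then B else C i.
  rewrite (_ : _ `&` _ = \bigcap_(i in [set: 'I_N]) (Z i @^-1` C' i)).
    rewrite !indT//; last by move=> i; rewrite /C'; case: ifP.
    rewrite [LHS](bigD1 j)//= [in RHS](bigD1 j)//= /C' eqxx Cj preimage_setT.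
    rewrite probability_setT mul1e muleC; congr (_ * _)%E.
    by apply: eq_bigr => i /negbTE->.
  apply/seteqP; split => w /=.
    by move=> [Cw Bw] i _; rewrite /C'; case: eqP => [->//|_]; exact: Cw.
  move=> C'w; split => [i _|]; last by have := C'w j I; rewrite /C' eqxx.
  by have := C'w i I; rewrite /= /C'; case: eqP => [->|]//; rewrite Cj.
- move=> _; rewrite /m1 /mrestr/= (le_lt_trans (probability_le1 _ _)) ?ltry//.
  by rewrite setTI.
Qed.

End CylinderIndependence.

(** * A Chernoff bound with frozen sample points *)

Section FrozenChernoff.
Context d (T : measurableType d) (R : realType) (P : probability T R).
Context d' (U : measurableType d') {N : nat} (Z : 'I_N -> T -> U).
Hypothesis mZ : forall i, measurable_fun setT (Z i).
Hypothesis indZ : mutually_independent P Z.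
Context (D : set (T * U)) (b : R).
Hypothesis b01 : 0 <= b <= 1.

Notation T_ j := (g_sigma_algebraType (cylinders Z j)).

(** [D] may depend on the sample, but not through [Z j]. *)
Let good (j : 'I_N) :=
  measurable (D : set (T_ j * U)%type) /\
  forall w, (b%:E <= P [set v | D (w, Z j v)])%E.

Let hit (j : 'I_N) (w : T) : R := \1_D (w, Z j w).

(** An affine upper bound of [expR (- hit j w)], with mean at most [1 - b / 2]. *)
Let thin (j : 'I_N) (w : T) : R := 1 - hit j w / 2.

Let measurable_hit j : good j -> measurable_fun setT (hit j).
Proof.
move=> [mD _]; apply: (@measurableT_comp _ _ _ _ _ _ (\1_D : T_ j * U -> R)).
  exact: measurable_indic.
by apply: measurable_fun_pair => //; exact: measurable_id_others.
Qed.

Let measurable_hit_others i j : i != j -> good j ->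
  measurable_fun setT (hit i : T_ j -> R).
Proof.
move=> ij [mD _]; apply: (@measurableT_comp _ _ _ _ _ _ (\1_D : T_ j * U -> R)).
  exact: measurable_indic.
by apply: measurable_fun_pair => //; exact: measurable_coord_others.
Qed.

Let half_ge0 z : 0 <= 1 - (\1_D z : R) / 2.
Proof. by rewrite indicE; case: (_ \in _); rewrite /=; lra. Qed.

Let b_half_ge0 : 0 <= 1 - b / 2.
Proof. by have /andP[b0 b1] := b01; lra. Qed.

Let thin_ge0 j w : 0 <= thin j w.
Proof. exact: half_ge0. Qed.

Let integral_half (A : set T) : measurable A -> (b%:E <= P A)%E ->
  (\int[P]_w (1 - \1_A w / 2)%:E <= (1 - b / 2)%:E)%E.
Proof.
move=> mA bA.
have i1 : P.-integrable setT (EFin \o cst (1 : R)).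
  exact: finite_measure_integrable_cst.
have iA : P.-integrable setT (EFin \o (fun w => \1_A w / 2)).
  rewrite (_ : EFin \o _ = (fun w => (2^-1)%:E * (\1_A w)%:E)%E); last first.
    by apply/funext => w /=; rewrite mulrC EFinM.
  by apply: integrableZl => //; exact: integrable_indic.
rewrite (integralB_EFin measurableT i1 iA) /= integral_cst//=.
rewrite probability_setT mule1.
under eq_integral do rewrite mulrC EFinM.
rewrite integralZl//; last exact: integrable_indic.
rewrite integral_indic//= setIT.
have /fineK <- : P A \is a fin_num by exact: fin_num_measure.
rewrite -EFinM -EFinB lee_fin.
have : b <= fine (P A) by rewrite -lee_fin fineK// fin_num_measure.
by lra.
Qed.

(** One factor is integrated at a time, given all the other variables. *)
Let integral_thin (K : {set 'I_N}) : (forall j, j \in K -> good j) ->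
  (\int[P]_w (\prod_(j in K) thin j w)%:E <= ((1 - b / 2) ^+ #|K|)%:E)%E.
Proof.
have [n] := ubnP #|K|; elim: n K => // n IH K cK gK.
have [->|[j jK]] := set_0Vmem K.
  rewrite cards0 expr0; under eq_integral do rewrite big_set0.
  by rewrite integral_cst//= probability_setT mule1.
have K'K i : i \in (K :\ j)%SET -> good i.
  by rewrite !inE => /andP[_ /gK].
have cKE : #|K| = #|(K :\ j)%SET|.+1 by rewrite (cardsD1 j) jK.
pose H w := \prod_(i in (K :\ j)%SET) thin i w.
have H0 w : 0 <= H w by apply: prodr_ge0 => i _.
have gj := gK _ jK; have [mD bD] := gj.
have mH : measurable_fun setT (H : T_ j -> R).
  rewrite /H; under eq_fun do rewrite -big_enum.
  apply: measurable_prod => i; rewrite mem_enum !inE => /andP[ij _].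
  apply: measurable_funB => //; apply: measurable_funM => //.
  exact: measurable_hit_others.
have mHT : measurable_fun setT H.
  by move=> _ A mA; apply: (measurable_others mZ); exact: mH.
pose F (z : T_ j * U) : \bar R := (H z.1 * (1 - \1_D z / 2))%:E.
have mF : measurable_fun setT F.
  apply/measurable_EFinP; apply: measurable_funM.
    exact: measurableT_comp.
  apply: measurable_funB => //; apply: measurable_funM => //.
have F0 z : (0 <= F z)%E.
  by rewrite lee_fin mulr_ge0.
have -> : (\int[P]_w (\prod_(i in K) thin i w)%:E = \int[P]_w F (w, Z j w))%E.
  by apply: eq_integral => w _; rewrite (big_setD1 j)//= mulrC.
rewrite (ge0_integral_independent2 (measurable_id_others mZ (j:=j)) (mZ j))//; last first.
  exact: independent2_others.
apply: (@le_trans _ _ (\int[P]_w ((1 - b / 2) * H w)%:E)%E).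
  apply: ge0_le_integral => //.
  - by move=> w _; apply: integral_ge0 => v _.
  - by move=> _ A mA; apply: (measurable_others mZ);
      exact: (measurable_integral_section P (mZ j) mF F0).
  - by apply/measurable_EFinP; exact: measurable_funM.
  - move=> w _; rewrite /F/=.
    have mDw : measurable [set v | D (w, Z j v)].
      rewrite -[X in measurable X]setTI.
      have mp : measurable_fun setT (fun v : T => ((w : T_ j), Z j v)).
        by apply: measurable_fun_pair => //; exact: mZ.
      exact: (mp measurableT _ mD).
    under eq_integral do rewrite EFinM.
    rewrite ge0_integralZl//; last 3 first.
    - apply/measurable_EFinP; apply: measurable_funB => //.
      by apply: measurable_funM => //; exact: measurable_indic.
    - by move=> v _; rewrite lee_fin; exact: half_ge0.
    - by rewrite lee_fin.
    rewrite mulrC EFinM lee_wpmul2l ?lee_fin//.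
    have := integral_half mDw (bD w).
    by [].
under eq_integral do rewrite EFinM.
rewrite ge0_integralZl//; last 2 first.
- exact/measurable_EFinP.
- by move=> w _; rewrite lee_fin.
rewrite cKE exprS EFinM lee_wpmul2l ?lee_fin//.
by apply: IH => //; rewrite -ltnS -cKE.
Qed.

(** Markov's inequality for [expR (s - hits)]. *)
Lemma frozen_chernoff (K : {set 'I_N}) (s : R) :
    (forall j, j \in K -> good j) ->
  measurable [set w | \sum_(j in K) hit j w <= s] /\
  (P [set w | (\sum_(j in K) hit j w <= s)%R] <=
    (expR (s - b / 2 * #|K|%:R))%:E)%E.
Proof.
move=> gK; set E := [set w | _].
have mhit j : measurable_fun setT (fun w => if j \in K then hit j w else 0).
  have [jK|_] := boolP (j \in K); last exact: measurable_cst.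
  exact: (measurable_hit (gK _ jK)).
have mhits : measurable_fun setT (fun w => \sum_(j in K) hit j w).
  under eq_fun do rewrite big_mkcond/=.
  exact: measurable_sum.
have mthins : measurable_fun setT (fun w => \prod_(j in K) thin j w).
  under eq_fun do rewrite -big_enum/=.
  apply: measurable_prod => j; rewrite mem_enum => /gK gj.
  apply: measurable_funB => //; apply: measurable_funM => //.
  exact: measurable_hit.
have mE : measurable E.
  by rewrite -[X in measurable X]setTI; exact: measurable_fun_le.
split => //.
have thin_exp j w : expR (- hit j w) <= thin j w.
  rewrite /thin /hit indicE; case: (_ \in _); last first.
    by rewrite oppr0 expR0 mul0r subr0.
  have := expRxMexpNx_1 (1 : R); have := expR_ge1Dx (1 : R).
  have := expR_ge0 (- 1 : R); rewrite /=; nra.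
have Ele w : E w -> 1 <= expR s * \prod_(j in K) thin j w.
  move=> Ew; rewrite -[leLHS]expR0 -(subrr s) expRD ler_wpM2l ?expR_ge0//.
  apply: (@le_trans _ _ (expR (- \sum_(j in K) hit j w))).
    by rewrite ler_expR lerN2.
  rewrite -sumrN expR_sum; apply: ler_prod => j _.
  by rewrite expR_ge0 thin_exp.
rewrite -[E]setIT -integral_indic//.
apply: (@le_trans _ _ (\int[P]_w ((expR s)%:E * (\prod_(j in K) thin j w)%:E))%E).
  apply: ge0_le_integral => //.
  - by apply/measurable_EFinP; exact: measurable_indic.
  - by apply: measurable_funeM; exact/measurable_EFinP.
  - move=> w _; rewrite -EFinM lee_fin indicE.
    have [/set_mem/Ele//|_] := boolP (w \in E).
    by rewrite mulr_ge0 ?expR_ge0// prodr_ge0.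
rewrite ge0_integralZl//; last 2 first.
- exact/measurable_EFinP.
- by move=> w _; rewrite lee_fin prodr_ge0.
rewrite expRD EFinM lee_wpmul2l ?lee_fin ?expR_ge0//.
apply: (le_trans (integral_thin gK)); rewrite lee_fin.
rewrite -[in leRHS]mulNr expRM_natr lerXn2r ?nnegrE ?expR_ge0//.
exact: expR_ge1Dx.
Qed.

End FrozenChernoff.

(** * An orthonormal basis of the span of the dictionary *)

Section SquareIntegrable.
Context d (T : measurableType d) (R : realType) (P : probability T R).
Implicit Types (g h : T -> R).

Definition ip g h : R := Rintegral P setT (fun w => g w * h w).

Local Notation L2 := (Lfun P 2%:E).

Lemma L2_measurable g : g \in L2 -> measurable_fun setT g.
Proof. by move=> /sub_Lfun_mfun; rewrite inE. Qed.

Lemma mem_L2 g : measurable_fun setT g -> ('E_P[fun w => (g w ^+ 2)%R] < +oo)%E ->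
  g \in L2.
Proof.
move=> mg; rewrite unlock => g2; apply/andP; split; rewrite inE//=.
rewrite /finite_norm unlock /Lnorm; apply: poweR_lty.
under eq_integral => w _ do rewrite /= powR_mulrn ?normr_ge0// real_normK ?num_real//.
exact: g2.
Qed.

Lemma L2D g h : g \in L2 -> h \in L2 -> (fun w => g w + h w) \in L2.
Proof. by move=> g2 h2; apply: (@Lfun_addr_closed _ _ _ P 2%:E (lee1n 2)).2. Qed.

Lemma L2Z (a : R) g : g \in L2 -> (fun w => a * g w) \in L2.
Proof.
move=> g2; have := Lfun_scale a (ler1n _ 2) g2.
by rewrite (_ : a \o* g = fun w => a * g w)//; apply/funext => w /=; rewrite mulrC.
Qed.

Lemma L2B g h : g \in L2 -> h \in L2 -> (fun w => g w - h w) \in L2.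
Proof.
move=> g2 h2; under eq_fun do rewrite -mulN1r.
by apply: L2D => //; exact: L2Z.
Qed.

Lemma L2_sum n (c : 'I_n -> R) (e : 'I_n -> T -> R) : (forall k, e k \in L2) ->
  (fun w => \sum_(k < n) c k * e k w) \in L2.
Proof.
move=> e2; elim: n c e e2 => [|n IH] c e e2.
  by under eq_fun do rewrite big_ord0; exact: Lfun_cst.
under eq_fun do rewrite big_ord_recr/=.
by apply: L2D; [exact: IH|exact: L2Z].
Qed.

Lemma integrable_mul g h : g \in L2 -> h \in L2 ->
  P.-integrable setT (EFin \o (fun w => g w * h w)).
Proof. by move=> g2 h2; apply/Lfun1_integrable; exact: Lfun2_mul_Lfun1. Qed.

Lemma ipC g h : ip g h = ip h g.
Proof. by apply: eq_Rintegral => w _; rewrite mulrC. Qed.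

Lemma ipDl g h k : g \in L2 -> h \in L2 -> k \in L2 ->
  ip (fun w => g w + h w) k = ip g k + ip h k.
Proof.
move=> g2 h2 k2; rewrite /ip -RintegralD//; try exact: integrable_mul.
by apply: eq_Rintegral => w _; rewrite mulrDl.
Qed.

Lemma ipZl (a : R) g k : g \in L2 -> k \in L2 ->
  ip (fun w => a * g w) k = a * ip g k.
Proof.
move=> g2 k2; rewrite /ip -RintegralZl//; last exact: integrable_mul.
by apply: eq_Rintegral => w _; rewrite mulrA.
Qed.

Lemma ipBl g h k : g \in L2 -> h \in L2 -> k \in L2 ->
  ip (fun w => g w - h w) k = ip g k - ip h k.
Proof.
move=> g2 h2 k2; under [in LHS]eq_fun do rewrite -mulN1r.
by rewrite ipDl ?ipZl ?mulN1r//; exact: L2Z.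
Qed.

Lemma ip_suml n (c : 'I_n -> R) (e : 'I_n -> T -> R) k :
  (forall i, e i \in L2) -> k \in L2 ->
  ip (fun w => \sum_(i < n) c i * e i w) k = \sum_(i < n) c i * ip (e i) k.
Proof.
move=> e2 k2; elim: n c e e2 => [|n IH] c e e2.
  rewrite big_ord0 /ip; under eq_Rintegral do rewrite big_ord0 mul0r.
  by rewrite Rintegral_cst// mul0r.
under [in LHS]eq_fun do rewrite big_ord_recr/=.
by rewrite big_ord_recr/= ipDl ?IH ?ipZl//; [exact: L2_sum|exact: L2Z].
Qed.

Lemma ip_ge0 g : 0 <= ip g g.
Proof. by apply: Rintegral_ge0 => w _; rewrite -expr2 sqr_ge0. Qed.

Lemma ip_expectation g : fine 'E_P[fun w => g w ^+ 2] = ip g g.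
Proof. by rewrite unlock; apply: eq_Rintegral => w _; rewrite expr2. Qed.

Lemma EFin_ip g h : g \in L2 -> h \in L2 ->
  (\int[P]_w (g w * h w)%:E)%E = (ip g h)%:E.
Proof.
move=> g2 h2; rewrite /ip /Rintegral fineK//.
by apply: integrable_fin_num => //; exact: integrable_mul.
Qed.

Lemma ip_eq0 g : g \in L2 -> ip g g = 0 -> P [set w | g w != 0] = 0%E.
Proof.
move=> g2 g0; have mg := L2_measurable g2.
have : (\int[P]_w `|(g w * g w)%:E| = 0)%E.
  under eq_integral => w _ do rewrite abse_EFin ger0_norm -?expr2 ?sqr_ge0// expr2.
  by rewrite EFin_ip// g0.
have mgg : measurable_fun setT (fun w => (g w * g w)%:E).
  by apply/measurable_EFinP; exact: measurable_funM.
move=> /(ae_eq_integral_abs P measurableT mgg)[B [mB PB0 sB]].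
apply/eqP; rewrite -measure_le0 -PB0; apply: le_measure; rewrite ?inE//.
  rewrite (_ : [set w | _] = ~` (g @^-1` [set 0])); last first.
    by apply/seteqP; split => w /= /eqP.
  by apply: measurableC; rewrite -[X in measurable X]setTI; exact: mg.
move=> w /= gw; apply: sB => /= /(_ I)[]/eqP.
by rewrite mulf_eq0 orbb (negbTE gw).
Qed.

End SquareIntegrable.

Section GramSchmidt.
Context d (T : measurableType d) (R : realType) (P : probability T R).
Context dX (XX : measurableType dX) (X : {RV P >-> XX}).
Context {M : nat} (f : 'I_M -> XX -> R).
Hypothesis mf : forall j, measurable_fun setT (f j).
Hypothesis f2 : forall j, (fun w => f j (X w)) \in Lfun P 2%:E.

Local Notation L2 := (Lfun P 2%:E).

Lemma lin_spanD g h : lin_span f g -> lin_span f h -> lin_span f (fun x => g x + h x).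
Proof.
move=> [s ->] [t ->]; exists (fun j => s j + t j); apply/funext => x.
by rewrite -big_split/=; apply: eq_bigr => j _; rewrite mulrDl.
Qed.

Lemma lin_spanZ (a : R) g : lin_span f g -> lin_span f (fun x => a * g x).
Proof.
move=> [s ->]; exists (fun j => a * s j); apply/funext => x.
by rewrite mulr_sumr; apply: eq_bigr => j _; rewrite mulrA.
Qed.

Lemma lin_spanB g h : lin_span f g -> lin_span f h -> lin_span f (fun x => g x - h x).
Proof.
move=> fg fh; under eq_fun do rewrite -mulN1r.
by apply: lin_spanD => //; exact: lin_spanZ.
Qed.

Lemma lin_span_sum n (c : 'I_n -> R) (e : 'I_n -> XX -> R) :
  (forall k, lin_span f (e k)) -> lin_span f (fun x => \sum_(k < n) c k * e k x).
Proof.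
move=> fe; elim: n c e fe => [|n IH] c e fe.
  exists (fun=> 0); apply/funext => x; rewrite big_ord0 big1// => j _.
  by rewrite mul0r.
under eq_fun do rewrite big_ord_recr/=.
by apply: lin_spanD; [exact: IH|exact: lin_spanZ].
Qed.

Lemma lin_span_gen j : lin_span f (f j).
Proof.
exists (fun i => (i == j)%:R); apply/funext => x.
rewrite (bigD1 j)//= eqxx mul1r big1 ?addr0// => i /negbTE->.
by rewrite mul0r.
Qed.

Lemma lin_span_measurable g : lin_span f g -> measurable_fun setT g.
Proof.
by move=> [t ->]; apply: measurable_sum => j; apply: measurable_funM.
Qed.

Lemma lin_span_L2 g : lin_span f g -> (fun w => g (X w)) \in L2.
Proof. by move=> [t ->]; exact: L2_sum. Qed.

(** A dictionary function whose remainder has zero norm adds no basis vector;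
    the points where this remainder does not vanish go to the null set [D]. *)
Lemma gram_schmidt_rec n : (n <= M)%N ->
  exists m (e : nat -> XX -> R) (a : 'I_M -> nat -> R) (D : set XX),
  [/\ (m <= n)%N, forall k, lin_span f (e k),
      forall k l, (k < m)%N -> (l < m)%N ->
        ip P (fun w => e k (X w)) (fun w => e l (X w)) = (k == l)%:R,
      measurable D /\ P (X @^-1` D) = 0%E &
      forall j : 'I_M, (j < n)%N -> forall x, ~ D x ->
        f j x = \sum_(k < m) a j k * e k x].
Proof.
elim: n => [_|n IH nM].
  exists 0%N, (fun _ _ => 0), (fun _ _ => 0), set0; split => //.
    move=> k; exists (fun=> 0); apply/funext => x; rewrite big1// => j _.
    by rewrite mul0r.
  by rewrite preimage_set0 measure0.
have [m [e [a [D [mn fe eo [mD PD] fa]]]]] := IH (ltnW nM).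
pose j0 := Ordinal nM.
have e2 k : (fun w => e k (X w)) \in L2 by exact: lin_span_L2.
pose c k := ip P (fun w => f j0 (X w)) (fun w => e k (X w)).
pose g x := f j0 x - \sum_(k < m) c k * e k x.
have fg : lin_span f g.
  by apply: lin_spanB; [exact: lin_span_gen|exact: lin_span_sum].
have g2 := lin_span_L2 fg.
have gE x : f j0 x = g x + \sum_(k < m) c k * e k x by rewrite /g subrK.
have ltnS_j0 (j : 'I_M) : (j < n.+1)%N -> j != j0 -> (j < n)%N.
  by rewrite ltnS leq_eqVlt => /orP[/eqP jn|//]; rewrite -val_eqE/= jn eqxx.
have ge l : (l < m)%N -> ip P (fun w => g (X w)) (fun w => e l (X w)) = 0.
  move=> lm; rewrite /g ipBl//; last by exact: L2_sum.
  rewrite (@ip_suml _ _ _ P m (fun k => c k) (fun k w => e k (X w)))//.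
  rewrite (bigD1 (Ordinal lm))//= eo// eqxx mulr1 big1 ?addr0 ?subrr// => k kl.
  by rewrite eo// -val_eqE/= in kl *; rewrite (negbTE kl) mulr0.
have [g0|g0] := eqVneq (ip P (fun w => g (X w)) (fun w => g (X w))) 0.
  exists m, e, (fun j k => if j == j0 then c k else a j k),
    (D `|` [set x | g x != 0]).
  have mg0 : measurable [set x | g x != 0].
    rewrite (_ : [set w | _] = ~` (g @^-1` [set 0])); last first.
      by apply/seteqP; split => w /= /eqP.
    apply: measurableC; rewrite -[X in measurable X]setTI.
    exact: (lin_span_measurable fg).
  split => //; first exact: leqW.
    split; first exact: measurableU.
    rewrite preimage_setU measureU0//; try exact: measurable_funPTI.
    exact: (ip_eq0 g2).
  move=> j jn x /not_orP[Dx /negP/negPn/eqP gx].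
  case: eqVneq => [->|jj0]; first by rewrite gE gx add0r.
  by apply: fa => //; exact: ltnS_j0.
pose s := Num.sqrt (ip P (fun w => g (X w)) (fun w => g (X w))).
have s0 : s != 0 by rewrite sqrtr_eq0 -ltNge lt_neqAle eq_sym g0 ip_ge0.
exists m.+1, (fun k => if k == m then fun x => s^-1 * g x else e k),
  (fun j k => if j == j0 then (if k == m then s else c k)
              else (if k == m then 0 else a j k)), D.
split => //.
- by move=> k; case: ifP => // _; exact: lin_spanZ.
- have gs l : (l < m)%N ->
      ip P (fun w => s^-1 * g (X w)) (fun w => e l (X w)) = 0.
    by move=> lm; rewrite ipZl// ge// mulr0.
  move=> k l; rewrite !ltnS.
  have [->|km] := eqVneq k m; have [->|lm] := eqVneq l m => kn ln.
  + rewrite ?eqxx ipZl//; last exact: L2Z.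
    rewrite ipC ipZl// -(@sqr_sqrtr _ (ip _ _ _)) ?ip_ge0// -/s.
    by rewrite expr2 mulKf// mulVf.
  + apply: gs; lia.
  + rewrite (negbTE km) ipC; apply: gs; lia.
  + apply: eo; lia.
- move=> j jn x Dx; rewrite big_ord_recr/= eqxx.
  under eq_bigr => k _ do rewrite (ltn_eqF (ltn_ord k)).
  case: eqVneq => [->|jj0]; first by rewrite gE addrC mulrA mulfV// mul1r.
  by rewrite mul0r addr0; apply: fa => //; exact: ltnS_j0.
Qed.

(** Outside a single null set of points the expansion holds for the whole span
    at once, which is what data-dependent elements of the span require. *)
Lemma gram_schmidt : exists m (e : 'I_m -> XX -> R) (D : set XX),
  [/\ (m <= M)%N, forall k, lin_span f (e k),
      forall k l, ip P (fun w => e k (X w)) (fun w => e l (X w)) = (k == l)%:R,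
      measurable D /\ P (X @^-1` D) = 0%E &
      forall h, lin_span f h -> exists b : 'cV[R]_m,
        forall x, ~ D x -> h x = \sum_(k < m) b k 0 * e k x].
Proof.
have [m [e [a [D [mM fe eo D0 fa]]]]] := gram_schmidt_rec (leqnn M).
exists m, (fun k => e k), D; split => //; first by move=> k l; exact: eo.
move=> _ [t ->]; exists (\col_k \sum_(j < M) t j * a j k) => x Dx.
under eq_bigr => j _ do rewrite (fa j (ltn_ord j) x Dx) mulr_sumr.
rewrite exchange_big/=; apply: eq_bigr => k _.
by rewrite mxE mulr_suml; apply: eq_bigr => j _; rewrite mulrA.
Qed.

End GramSchmidt.

(** * The small-ball estimate, uniformly over directions *)

Section MeasurableMatrices.
Context d (T : measurableType d) (R : realType).

Definition measurable_mx p q (A : T -> 'M[R]_(p, q)) :=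
  forall i j, measurable_fun setT (fun w => A w i j).

Lemma measurable_mx_mul p q r (A : T -> 'M[R]_(p, q)) (B : T -> 'M[R]_(q, r)) :
  measurable_mx A -> measurable_mx B -> measurable_mx (fun w => A w *m B w).
Proof.
move=> mA mB i j; under eq_fun do rewrite mxE.
by apply: measurable_sum => k; apply: measurable_funM.
Qed.

Lemma measurable_mx_tr p q (A : T -> 'M[R]_(p, q)) :
  measurable_mx A -> measurable_mx (fun w => (A w)^T).
Proof. by move=> mA i j; under eq_fun do rewrite mxE; exact: mA. Qed.

Lemma measurable_mx_sum (I : finType) (S : {set I}) p q
    (A : I -> T -> 'M[R]_(p, q)) :
  (forall k, k \in S -> measurable_mx (A k)) ->
  measurable_mx (fun w => \sum_(k in S) A k w).
Proof.
move=> mA i j; under eq_fun do rewrite summxE big_mkcond/=.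
apply: measurable_sum => k; have [kS|_] := boolP (k \in S); last exact: measurable_cst.
exact: mA.
Qed.

Lemma measurable_mx_scale p q (a : R) (A : T -> 'M[R]_(p, q)) :
  measurable_mx A -> measurable_mx (fun w => a *: A w).
Proof.
by move=> mA i j; under eq_fun do rewrite mxE; apply: measurable_funM.
Qed.

Lemma measurable_det p (A : T -> 'M[R]_p) :
  measurable_mx A -> measurable_fun setT (fun w => \det (A w)).
Proof.
move=> mA; apply: measurable_sum => s; apply: measurable_funM => //.
by apply: measurable_prod => i _; exact: mA.
Qed.

Lemma measurable_mx_adj p (A : T -> 'M[R]_p) :
  measurable_mx A -> measurable_mx (fun w => \adj (A w)).
Proof.
move=> mA i j; under eq_fun do rewrite mxE.
apply: measurable_funM => //; apply: measurable_det => k l.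
by under eq_fun do rewrite !mxE; exact: mA.
Qed.

End MeasurableMatrices.

Section MeasurableCandidates.
Context d (T : measurableType d) (R : realType) {m N : nat}.

(** Only the points used by the configuration have to be measurable: with respect
    to the sigma-algebra of the other variables, this makes the candidate
    independent of each point that it does not use. *)
Lemma measurable_candidate (x : 'I_N -> T -> 'cV[R]_m) (g : config (m := m) (N := N)) :
  (forall i, inl i \in supp g -> measurable_mx (x i)) ->
  measurable_mx (fun w => candidate (fun i => x i w) g).
Proof.
move=> mx.
have mp i : i \in supp g -> measurable_mx (fun w => pool (fun i => x i w) i).
  by case: i => [i|k] ig /=; [exact: mx|move=> ? ?; exact: measurable_cst].
apply: measurable_mx_mul.
  apply: measurable_mx_adj; apply: measurable_mx_sum => i ig.
  by apply: measurable_mx_mul; [exact: mp|apply: measurable_mx_tr; exact: mp].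
by apply: measurable_mx_sum => i ig; apply: measurable_mx_scale; exact: mp.
Qed.

Lemma measurable_dot (u v : T -> 'cV[R]_m) :
  measurable_mx u -> measurable_mx v ->
  measurable_fun setT (fun w => dot (u w) (v w)).
Proof.
by move=> mu mv; apply: measurable_sum => k; apply: measurable_funM.
Qed.

End MeasurableCandidates.

Lemma union_bound d (T : measurableType d) (R : realType) (P : probability T R)
    (I : finType) (S : {set I}) (E : I -> set T) (q : R) :
  (forall i, i \in S -> measurable (E i) /\ (P (E i) <= q%:E)%E) ->
  measurable (\big[setU/set0]_(i in S) E i) /\
  (P (\big[setU/set0]_(i in S) E i) <= (#|S|%:R * q)%:E)%E.
Proof.
move=> ES; rewrite -big_enum/= cardE.
have {}ES i : i \in enum S -> measurable (E i) /\ (P (E i) <= q%:E)%E.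
  by rewrite mem_enum; exact: ES.
elim: (enum S) ES => [|i s IH] ES.
  by rewrite big_nil measure0 mul0r; split => //; exact: measurable0.
have [|ms Ps] := IH; first by move=> k ks; apply: ES; rewrite inE ks orbT.
have [mi Pi] := ES i (mem_head _ _).
rewrite big_cons; split; first exact: measurableU.
apply: (le_trans (measureU2 _ mi ms)).
by rewrite -natr1 mulrDl mul1r addrC EFinD leeD.
Qed.

Section UniformSmallBall.
Context d (T : measurableType d) (R : realType) (P : probability T R).
Context dX (XX : measurableType dX) {N m : nat} (Z : 'I_N -> T -> XX).
Context (V : XX -> 'cV[R]_m) (b c : R).
Hypothesis mZ : forall i, measurable_fun setT (Z i).
Hypothesis indZ : mutually_independent P Z.
Hypothesis mV : measurable_mx V.
Hypothesis b01 : 0 < b <= 1.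
Hypothesis c0 : 0 < c.
Hypothesis small_ball : forall i t,
  (b%:E <= P [set w | (c * dot t t <= dot t (V (Z i w)) ^+ 2)%R])%E.

Let cand (g : config (m := m) (N := N)) w := candidate (fun i => V (Z i w)) g.

Let far g : set (T * XX) :=
  [set z | c * dot (cand g z.1) (cand g z.1) <= dot (cand g z.1) (V z.2) ^+ 2].

Let fresh (g : config (m := m) (N := N)) : {set 'I_N} :=
  [set j | inl j \notin supp g]%SET.

Let few g : set T :=
  [set w | \sum_(j in fresh g) \1_(far g) (w, Z j w) <= b * N%:R / 8].

Let frugal : {set config (m := m) (N := N)} := [set g | (#|supp g| <= m)%N]%SET.

Let few_bound g : (#|supp g| <= m)%N ->
  measurable (few g) /\
  (P (few g) <= (expR (b * N%:R / 8 - b / 2 * (N%:R - m%:R)))%:E)%E.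
Proof.
move=> gm; have /andP[b0 b1] := b01.
have b01' : 0 <= b <= 1 by rewrite (ltW b0).
have [|mfew Pfew] :=
    @frozen_chernoff _ _ _ P _ _ _ Z mZ indZ (far g) b b01' (fresh g) (b * N%:R / 8).
  move=> j; rewrite inE => jg; split; last by move=> w; exact: (small_ball j (cand g w)).
  have mcand : measurable_mx (cand g : g_sigma_algebraType (cylinders Z j) -> _).
    apply: measurable_candidate => i ig k l.
    apply: (measurableT_comp (mV k l)); apply: measurable_coord_others => //.
    by apply: contraNneq jg => <-.
  rewrite /far -[X in measurable X]setTI; apply: measurable_fun_le => //.
    apply: measurable_funM => //; apply: measurable_dot => k l;
      exact: (measurableT_comp (mcand k l)).
  apply: measurable_funX; apply: measurable_dot => k l.
    exact: (measurableT_comp (mcand k l)).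
  exact: (measurableT_comp (mV k l)).
split => //; apply: (le_trans Pfew); rewrite lee_fin ler_expR lerB//.
rewrite ler_wpM2l ?divr_ge0 ?(ltW b0)// lerBlDr -natrD ler_nat.
rewrite -[leqLHS]card_ord -(cardC (mem (fresh g))) leq_add2l.
apply: leq_trans gm; rewrite -(card_imset _ (@inl_inj 'I_N 'I_m)).
apply: subset_leq_card; apply/fintype.subsetP => i /imsetP[j jg ->].
by move: jg; rewrite !inE negbK.
Qed.

(** The exceptional set is the finite union, over the configurations with at most
    [m] points, of the events that the candidate is seen by few of the sample
    points that it does not use. Any direction seen by few points leads, by
    [candidate_exists], to such a candidate. *)
Lemma uniform_small_ball :
  (b / 100)^-1 * m%:R + 3 * (b / 100) * (N%:R + m%:R)
    + (b * N%:R / 8 - b / 2 * (N%:R - m%:R)) <= - (b ^+ 2 * N%:R / 4) ->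
  exists A : set T, [/\ measurable A,
    (P A <= (expR (- (b ^+ 2 * N%:R / 4)))%:E)%E &
    forall w, ~ A w -> forall t, t != 0 ->
      b * N%:R / 8 <=
        #|[set i | (c * dot t t <= dot t (V (Z i w)) ^+ 2)%R]%SET|%:R].
Proof.
move=> expo; have /andP[b0 b1] := b01.
have [|mA PA] := @union_bound _ _ _ P _ frugal few
    (expR (b * N%:R / 8 - b / 2 * (N%:R - m%:R))).
  by move=> g; rewrite inE; exact: few_bound.
exists (\big[setU/set0]_(g in frugal) few g); split => //.
  apply: (le_trans PA); rewrite lee_fin.
  apply: le_trans (_ : expR _ <= _); last by rewrite ler_expR; exact: expo.
  rewrite [leRHS]expRD ler_wpM2r ?expR_ge0// expRD.
  (* [b / 100] is the weight of a chosen point in [small_support_count] *)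
  have l0 : 0 < b / 100 by rewrite divr_gt0.
  have l01 : 0 <= b / 100 <= 1 by rewrite (ltW l0)/=; lra.
  have := @small_support_count R ('I_N + 'I_m)%type 'I_3 m _ l01.
  rewrite card_sum !card_ord -ler_pdivlMr ?exprn_gt0// => /le_trans; apply.
  rewrite [leLHS]mulrC ler_pM ?invr_ge0 ?exprn_ge0 ?addr_ge0 ?mulr_ge0//;
    rewrite ?(ltW l0) ?(ltW b0)//.
    rewrite -exprVn expRM_natr lerXn2r ?nnegrE ?invr_ge0 ?expR_ge0 ?(ltW l0)//.
    by apply: le_trans (expR_ge1Dx _); rewrite lerDr.
  rewrite -natrD expRM_natr lerXn2r ?nnegrE ?expR_ge0 ?expR_ge1Dx//.
  lra.
move=> w Aw t t0; rewrite leNgt; apply/negP => hits; apply: Aw.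
pose J : {set 'I_N} := [set i | dot t (V (Z i w)) ^+ 2 < c * dot t t]%SET.
have tJ i : i \in J -> dot t (V (Z i w)) ^+ 2 < c * dot t t by rewrite inE.
have [g [gm gJ]] := candidate_exists c0 t0 tJ.
rewrite (bigD1 g) ?inE//=; left; rewrite /few /=.
apply: le_trans (ltW hits); rewrite -sum1_card natr_sum.
rewrite [leLHS]big_mkcond [leRHS]big_mkcond; apply: ler_sum => j _.
rewrite !inE /= indicE; case: ifP => _; last by case: ifP.
have [|_] := boolP ((w, Z j w) \in far g); last by case: ifP.
rewrite inE /far /= => gfar; case: ifPn => //; rewrite -ltNge => tj.
have : j \in J by rewrite inE.
by move=> /gJ; rewrite ltNge gfar.
Qed.

End UniformSmallBall.

(** * The noise *)

Section IdenticallyDistributed.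
Context d (T : measurableType d) (R : realType) (P : probability T R).
Context d' (U : measurableType d').

Lemma ge0_integral_same_distribution (Z Z' : T -> U) (g : U -> \bar R) :
  measurable_fun setT Z -> measurable_fun setT Z' -> same_distribution P Z Z' ->
  measurable_fun setT g -> (forall u, (0 <= g u)%E) ->
  (\int[P]_w g (Z w) = \int[P]_w g (Z' w))%E.
Proof.
move=> mZ mZ' ZZ' mg g0.
pose W : {mfun T >-> U} := mfun_Sub (mem_set mZ).
pose W' : {mfun T >-> U} := mfun_Sub (mem_set mZ').
rewrite -[LHS](@ge0_integral_distribution _ _ _ _ _ P W g)//.
rewrite -[RHS](@ge0_integral_distribution _ _ _ _ _ P W' g)//.
by apply: eq_measure_integral => A mA _; exact: ZZ'.
Qed.

Lemma integral_same_distribution (Z Z' : T -> U) (g : U -> \bar R) :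
  measurable_fun setT Z -> measurable_fun setT Z' -> same_distribution P Z Z' ->
  measurable_fun setT g -> P.-integrable setT (g \o Z) ->
  P.-integrable setT (g \o Z') ->
  (\int[P]_w g (Z w) = \int[P]_w g (Z' w))%E.
Proof.
move=> mZ mZ' ZZ' mg ig ig'.
pose W : {mfun T >-> U} := mfun_Sub (mem_set mZ).
pose W' : {mfun T >-> U} := mfun_Sub (mem_set mZ').
rewrite -[LHS](@integral_distribution _ _ _ _ _ P W g)//.
rewrite -[RHS](@integral_distribution _ _ _ _ _ P W' g)//.
by apply: eq_measure_integral => A mA _; exact: ZZ'.
Qed.

Lemma mutually_independent_comp d2 (U2 : measurableType d2) (g : U -> U2)
    N (Z : 'I_N -> T -> U) :
  measurable_fun setT g -> mutually_independent P Z ->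
  mutually_independent P (fun i => g \o Z i).
Proof.
move=> mg indZ J B mB; apply: (indZ J (fun i => g @^-1` B i)) => i.
by rewrite -[X in measurable X]setTI; exact: mg.
Qed.

Lemma same_distribution_comp d2 (U2 : measurableType d2) (g : U -> U2)
    (Z Z' : T -> U) :
  measurable_fun setT g -> same_distribution P Z Z' ->
  same_distribution P (g \o Z) (g \o Z').
Proof.
move=> mg ZZ' B mB; apply: (ZZ' (g @^-1` B)).
by rewrite -[X in measurable X]setTI; exact: mg.
Qed.

Lemma mutually_independent_pair N (Z : 'I_N -> T -> U) i j :
  mutually_independent P Z -> i != j -> independent2 P (Z i) (Z j).
Proof.
move=> indZ ij A B mA mB.
pose C k := if k == i then A else B.
have mC k : measurable (C k) by rewrite /C; case: ifP.
have := indZ [set i; j]%SET C mC.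
rewrite big_setU1 ?inE//= big_set1 /C eqxx (negbTE _ : j == i = false); last first.
  by rewrite eq_sym.
move=> <-; congr (P _); apply/seteqP; split => w /=.
  move=> [Aw Bw] k /=; rewrite !inE => /orP[|] /eqP->; rewrite ?eqxx//.
  by rewrite eq_sym (negbTE ij).
move=> h; split.
  by have := h i; rewrite /= !inE eqxx => /(_ isT).
by have := h j; rewrite /= !inE eqxx orbT eq_sym (negbTE ij) => /(_ isT).
Qed.

Local Notation L2 := (Lfun P 2%:E).

(** Centred independent variables are orthogonal, so only the [N] diagonal terms
    of the square remain. *)
Lemma iid_mean_square N (Z : 'I_N -> T -> U) (Z0 : T -> U) (g : U -> R) (v : R) :
  (forall i, measurable_fun setT (Z i)) -> measurable_fun setT Z0 ->
  iid_copies P Z Z0 -> measurable_fun setT g -> (fun w => g (Z0 w)) \in L2 ->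
  (\int[P]_w (g (Z0 w))%:E = 0)%E ->
  ip P (fun w => g (Z0 w)) (fun w => g (Z0 w)) <= v ->
  let W w := N%:R^-1 * \sum_(i < N) g (Z i w) in
  W \in L2 /\ ip P W W <= v / N%:R.
Proof.
move=> mZ mZ0 [indZ sZ] mg g2 g0 gv W.
have mg2 : measurable_fun setT (fun u => (g u * g u)%:E).
  by apply/measurable_EFinP; exact: measurable_funM.
have gZE i : (\int[P]_w (g (Z i w) * g (Z i w))%:E =
              \int[P]_w (g (Z0 w) * g (Z0 w))%:E)%E.
  apply: (ge0_integral_same_distribution (mZ i) mZ0 (sZ i) mg2) => u.
  by rewrite lee_fin -expr2 sqr_ge0.
have gZ2 i : (fun w => g (Z i w)) \in L2.
  apply: mem_L2; first exact: measurableT_comp.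
  rewrite unlock; under eq_integral do rewrite expr2.
  by rewrite gZE (EFin_ip g2 g2) ltry.
have gZ1 i : P.-integrable setT (EFin \o (fun w => g (Z i w))).
  by apply/Lfun1_integrable; apply: (Lfun_subset12 _ (gZ2 i)); exact: fin_num_measure.
have g1 : P.-integrable setT (EFin \o (fun w => g (Z0 w))).
  by apply/Lfun1_integrable; apply: (Lfun_subset12 _ g2); exact: fin_num_measure.
have gZ0 i : (\int[P]_w (g (Z i w))%:E = 0)%E.
  rewrite -g0; apply: (integral_same_distribution (g := EFin \o g)) => //.
  - exact/measurable_EFinP.
  - exact: gZ1.
have cross i j : i != j -> ip P (fun w => g (Z i w)) (fun w => g (Z j w)) = 0.
  move=> ij; rewrite /ip /Rintegral.
  rewrite (@integral_mul_independent2_eq0 _ _ _ P)//.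
  - exact: measurableT_comp.
  - exact: measurableT_comp.
  - move=> A B mA mB.
    have := mutually_independent_pair indZ ij (A := g @^-1` A) (B := g @^-1` B).
    by apply; rewrite -[X in measurable X]setTI; exact: mg.
  - exact: integrable_mul.
have diag i : ip P (fun w => g (Z i w)) (fun w => g (Z i w)) <= v.
  apply: le_trans gv; rewrite -lee_fin -!EFin_ip//.
  by rewrite gZE.
have WE : W = fun w => \sum_(i < N) N%:R^-1 * g (Z i w).
  by apply/funext => w; rewrite /W mulr_sumr.
split; first by rewrite WE; exact: (@L2_sum _ _ _ P _ (fun=> _)).
have W2 : W \in L2 by rewrite WE; exact: (@L2_sum _ _ _ P _ (fun=> _)).
rewrite {1}WE (@ip_suml _ _ _ P N (fun=> N%:R^-1))//.
have ipW i : ip P (fun w => g (Z i w)) W <= v / N%:R.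
  rewrite ipC WE (@ip_suml _ _ _ P N (fun=> N%:R^-1) (fun i w => g (Z i w)))//.
  rewrite (bigD1 i)//= big1 ?addr0 => [|j ji]; last by rewrite cross// mulr0.
  by rewrite mulrC ler_wpM2r// invr_ge0.
apply: (@le_trans _ _ (\sum_(i < N) N%:R^-1 * (v / N%:R))).
  by apply: ler_sum => i _; rewrite ler_wpM2l// invr_ge0.
rewrite sumr_const card_ord -mulrnAl -[_ *+ N]mulr_natr.
have [N0|N0] := eqVneq (N%:R : R) 0; first by rewrite N0 invr0 !mulr0.
by rewrite mulVf// mul1r.
Qed.

End IdenticallyDistributed.

Section Markov.
Context d (T : measurableType d) (R : realType) (P : probability T R).

(** The strict inequality in the event covers [q = 0], where [g] vanishes almost
    everywhere. *)
Lemma markov_gt (g : T -> R) (q x : R) : 0 < x -> measurable_fun setT g ->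
  (forall w, 0 <= g w) -> (\int[P]_w (g w)%:E <= q%:E)%E ->
  measurable [set w | q * x < g w] /\
  (P [set w | (q * x < g w)%R] <= (1 / x)%:E)%E.
Proof.
move=> x0 mg g0 gq; set E := [set w | _].
have mE : measurable E.
  rewrite -[E]setTI.
  have := measurable_fun_ltr (measurable_cst (q * x)) mg measurableT.
  by move=> /(_ [set true] I); rewrite setTI.
split => //.
have q0 : 0 <= q.
  by rewrite -lee_fin; apply: le_trans gq; apply: integral_ge0 => w _; rewrite lee_fin.
have := q0; rewrite le_eqVlt => /orP[/eqP qE|q_gt0].
  suff -> : P E = 0%E by rewrite lee_fin divr_ge0// ltW.
  have : (\int[P]_w `|(g w)%:E| = 0)%E.
    under eq_integral => w _ do rewrite abse_EFin ger0_norm//.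
    apply: le_anti; apply/andP; split; first by move: gq; rewrite -qE.
    apply: integral_ge0 => w _.
    by rewrite lee_fin.
  have mg' : measurable_fun setT (fun w => (g w)%:E) by exact/measurable_EFinP.
  move=> /(ae_eq_integral_abs P measurableT mg')[B [mB PB0 sB]].
  apply/eqP; rewrite -measure_le0 -PB0; apply: le_measure; rewrite ?inE//.
  move=> w; rewrite /E /= -qE mul0r => gw; apply: sB => /= /(_ I)[] gw0.
  by rewrite gw0 ltxx in gw.
have : ((q * x)%:E * P E <= q%:E)%E.
  apply: le_trans gq; rewrite -[E]setIT -integral_indic//.
  rewrite -ge0_integralZl//; last 2 first.
  - by apply/measurable_EFinP; exact: measurable_indic.
  - by rewrite lee_fin mulr_ge0// ltW.
  apply: ge0_le_integral => //.
  - by move=> w _; rewrite lee_fin mulr_ge0// mulr_ge0// ltW.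
  - by apply: measurable_funeM; apply/measurable_EFinP; exact: measurable_indic.
  - exact/measurable_EFinP.
  - move=> w _; rewrite -EFinM lee_fin indicE.
    have [/set_mem/ltW|_] := boolP (w \in E); first by rewrite mulr1.
    by rewrite mulr0.
rewrite muleC -lee_pdivlMr ?mulr_gt0//.
by move=> /le_trans; apply; rewrite -EFinM lee_fin invfM mulrA mulfV ?gt_eqF.
Qed.

End Markov.

(** * Least squares *)

Section ErmInequality.
Context {R : realFieldType} {m : nat}.
Implicit Types (u v : 'cV[R]_m).

Lemma dot_CauchySchwarz u v : dot u v ^+ 2 <= dot u u * dot v v.
Proof.
have [->|u0] := eqVneq u 0.
  have d0 t : dot 0 t = 0 :> R by rewrite /dot big1// => k _; rewrite mxE mul0r.
  by rewrite !d0 expr0n mul0r.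
have uu := dot_gt0 u0.
have := dot_ge0 (dot u u *: v + - dot u v *: u).
rewrite !(dotDl, dotZl) (dotC v) (dotC u (_ + _)) !(dotDl, dotZl) (dotC v u).
set a := dot u u in uu *; set l := dot u v; set q := dot v v => h.
have : 0 <= a * (a * q - l ^+ 2) by rewrite (le_trans h)//; lra.
by rewrite pmulr_rge0// subr_ge0.
Qed.

(** Expanding the squares, the empirical comparison reads
    [\sum_i dot t (p i) ^+ 2 <= 2 * N * dot t W]. The left-hand side is at least
    [a * N / 8 * (c * dot t t)] by the small-ball count, and Cauchy-Schwarz bounds
    the right-hand side: 16 is 2 times 8. *)
Lemma erm_dot_bound N (z : 'I_N -> R) (p : 'I_N -> 'cV[R]_m) t W (a c : R) :
    W = N%:R^-1 *: \sum_(i < N) z i *: p i ->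
    0 < a -> 0 < c -> t != 0 ->
    \sum_(i < N) (z i - dot t (p i)) ^+ 2 <= \sum_(i < N) z i ^+ 2 ->
    a * N%:R / 8 <= #|[set i | (c * dot t t <= dot t (p i) ^+ 2)%R]%SET|%:R ->
  (0 < N)%N ->
  dot t t <= (16 / (a * c)) ^+ 2 * dot W W.
Proof.
move=> WE a0 c0 t0 erm hits N0.
have tt := dot_gt0 t0.
have NR : 0 < N%:R :> R by rewrite ltr0n.
have quad : (\sum_(i < N) dot t (p i) ^+ 2 <= 2 * (N%:R * dot t W))%R.
  have -> : N%:R * dot t W = \sum_(i < N) z i * dot t (p i).
    rewrite WE dotC dotZl mulrA divff ?gt_eqF// mul1r.
    rewrite (big_morph (fun w => dot w t) (fun a b => dotDl a b t)
      (_ : dot 0 t = 0)); last by rewrite /dot big1// => k _; rewrite mxE mul0r.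
    by apply: eq_bigr => i _; rewrite dotZl dotC.
  rewrite -subr_ge0 in erm; rewrite -subr_ge0; apply: le_trans erm _.
  rewrite -sumrB mulr_sumr -sumrB; apply: ler_sum => i _.
  by rewrite le_eqVlt; apply/orP; left; apply/eqP; ring.
have lower : a * N%:R / 8 * (c * dot t t) <= \sum_(i < N) dot t (p i) ^+ 2.
  apply: le_trans (_ : #|[set i | (c * dot t t <= dot t (p i) ^+ 2)%R]%SET|%:R *
    (c * dot t t) <= _).
    by rewrite ler_wpM2r// mulr_ge0 ?ltW.
  rewrite mulr_natl -sumr_const big_mkcond; apply: ler_sum => i _.
  by rewrite inE; case: ifP => // _; exact: sqr_ge0.
have key : a * c * dot t t <= 16 * dot t W.
  rewrite -(ler_pM2l NR); have := le_trans lower quad; lra.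
have cs := dot_CauchySchwarz t W.
rewrite expr_div_n mulrAC ler_pdivlMr ?exprn_gt0 ?mulr_gt0//.
rewrite -(ler_pM2l tt).
have ac : 0 < a * c by rewrite mulr_gt0.
have : (a * c * dot t t) ^+ 2 <= (16 * dot t W) ^+ 2.
  by rewrite ler_sqr ?nnegrE ?(le_trans _ key)// mulr_ge0 ?ltW.
rewrite !exprMn; nra.
Qed.

End ErmInequality.

Section Projection.
Context d (T : measurableType d) (R : realType) (P : probability T R).
Local Notation L2 := (Lfun P 2%:E).

Lemma ip_sqB (z g : T -> R) : z \in L2 -> g \in L2 ->
  ip P (fun w => z w - g w) (fun w => z w - g w) =
  ip P z z - 2 * ip P z g + ip P g g.
Proof.
move=> z2 g2; have zg := L2B z2 g2.
rewrite ipBl// (ipC _ z) (ipC _ g) !ipBl// (ipC _ g z).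
by ring.
Qed.

(** The choice [s = a / (q + 1)], with [a] the inner product of
    [z] and [g] and [q] the squared norm of [g], is the
    minimizer up to the 1 that avoids a division by zero. *)
Lemma projection_orthogonal (z g : T -> R) : z \in L2 -> g \in L2 ->
  (forall s : R, ip P z z <= ip P (fun w => z w - s * g w) (fun w => z w - s * g w)) ->
  ip P z g = 0.
Proof.
move=> z2 g2 zmin; set a := ip P z g; set q := ip P g g.
have q0 : 0 <= q by exact: ip_ge0.
have := zmin (a / (q + 1)); rewrite ip_sqB//; last exact: L2Z.
have g2s := L2Z (a / (q + 1)) g2.
rewrite ipZl// (ipC _ z) (ipC _ g) !ipZl// (ipC _ g z) -/a -/q => h.
have q1 : 0 < q + 1 by rewrite ltr_wpDl.
have h2 : 0 <= a ^+ 2 * (- q - 2) / (q + 1) ^+ 2.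
  rewrite -subr_ge0 in h; rewrite (le_trans h)// le_eqVlt; apply/orP; left.
  by apply/eqP; field; rewrite gt_eqF.
have qn0 : (q + 1) ^+ 2 != 0 by rewrite gt_eqF// exprn_gt0.
have : 0 <= a ^+ 2 * (- q - 2).
  by rewrite -[leRHS](divfK qn0) mulr_ge0// exprn_ge0// ltW.
move=> h3; apply/eqP; rewrite -sqrf_eq0 eq_le sqr_ge0 andbT; nra.
Qed.

End Projection.

Section Oracle.
Context d (T : measurableType d) (R : realType) (P : probability T R).
Context dX (XX : measurableType dX) (X : {RV P >-> XX}) (Y : T -> R).
Context {M : nat} (f : 'I_M -> XX -> R) (fstar : XX -> R).
Hypothesis Y2 : Y \in Lfun P 2%:E.
Hypothesis f2 : forall j, (fun w => f j (X w)) \in Lfun P 2%:E.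
Hypothesis fs : lin_span f fstar.
Hypothesis oracle : risk P X Y fstar = inf [set risk P X Y h | h in lin_span f].

Let zeta w := Y w - fstar (X w).

Lemma residual_L2 : zeta \in Lfun P 2%:E.
Proof. by apply: L2B => //; exact: lin_span_L2 fs. Qed.

Lemma risk_shift g : risk P X Y (fun u => fstar u + g u) =
  ip P (fun w => zeta w - g (X w)) (fun w => zeta w - g (X w)).
Proof.
rewrite /risk ip_expectation; apply: eq_Rintegral => w _.
by rewrite /zeta; congr (_ * _); ring.
Qed.

Lemma residual_orthogonal g : lin_span f g -> ip P zeta (fun w => g (X w)) = 0.
Proof.
move=> fg; apply: projection_orthogonal; first exact: residual_L2.
  exact: lin_span_L2 fg.
move=> s; rewrite -(risk_shift (fun u => s * g u)).
rewrite -(ip_expectation P zeta) -[fine _]/(risk P X Y fstar) oracle.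
apply: ge_inf.
  by exists 0 => _ [h _ <-]; rewrite /risk ip_expectation ip_ge0.
exists (fun u => fstar u + s * g u) => //.
by apply: lin_spanD => //; exact: lin_spanZ.
Qed.

Lemma L2norm_sq h : L2norm P X h ^+ 2 = ip P (fun w => h (X w)) (fun w => h (X w)).
Proof. by rewrite /L2norm ip_expectation sqr_sqrtr// ip_ge0. Qed.

Lemma excess_risk h : lin_span f h ->
  L2norm P X (fun u => h u - fstar u) ^+ 2
  = risk P X Y h - inf [set risk P X Y h | h in lin_span f].
Proof.
move=> fh; have fhs : lin_span f (fun u => h u - fstar u) by exact: lin_spanB.
have -> : risk P X Y h = risk P X Y (fun u => fstar u + (h u - fstar u)).
  by congr (risk P X Y _); apply/funext => u; rewrite addrC subrK.
rewrite -oracle L2norm_sq (risk_shift (fun u => h u - fstar u)).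
rewrite (ip_sqB residual_L2 (lin_span_L2 f2 fhs)) (residual_orthogonal fhs).
by rewrite mulr0 subr0 /risk ip_expectation [X in X - _]addrC addrK.
Qed.

End Oracle.

Section OrthonormalSystem.
Context d (T : measurableType d) (R : realType) (P : probability T R).
Local Notation L2 := (Lfun P 2%:E).

Lemma ip_orthonormal m (e : 'I_m -> T -> R) (b : 'cV[R]_m) :
  (forall k, e k \in L2) -> (forall k l, ip P (e k) (e l) = (k == l)%:R) ->
  ip P (fun w => \sum_(k < m) b k 0 * e k w) (fun w => \sum_(k < m) b k 0 * e k w)
  = dot b b.
Proof.
move=> e2 eo; have b2 := L2_sum (fun k => b k 0) e2.
rewrite (ip_suml (fun k => b k 0) e2 b2); apply: eq_bigr => k _; congr (_ * _).
rewrite ipC (ip_suml (fun k => b k 0) e2 (e2 k)).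
rewrite (bigD1 k)//= eo eqxx mulr1 big1 ?addr0// => l /negbTE lk.
by rewrite eo lk mulr0.
Qed.

Lemma eq_ip_off_null (u v : T -> R) (D : set T) :
  measurable_fun setT u -> measurable_fun setT v ->
  measurable D -> P D = 0%E -> (forall w, ~ D w -> u w = v w) ->
  ip P u u = ip P v v.
Proof.
move=> mu mv mD PD uv; congr fine; apply: ae_eq_integral => //.
- by apply/measurable_EFinP; exact: measurable_funM.
- by apply/measurable_EFinP; exact: measurable_funM.
exists D; split => // w /= h; apply: contrapT => Dw; apply: h => _.
by rewrite (uv _ Dw).
Qed.

(** Independence factors the integral; a bounded noise is pulled out of it. *)
Lemma noise_moment dX (XX : measurableType dX) (X : T -> XX) (zeta : T -> R)
    (e : XX -> R) (sigma : R) :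
  measurable_fun setT X -> measurable_fun setT zeta -> measurable_fun setT e ->
  (fun w => e (X w)) \in L2 ->
  ip P (fun w => e (X w)) (fun w => e (X w)) = 1 ->
  (independent2 P zeta X /\ ('E_P[fun w => (zeta w ^+ 2)%R] <= (sigma ^+ 2)%:E)%E)
    \/ {ae P, forall w, `|zeta w| <= sigma} ->
  (\int[P]_w ((zeta w * e (X w)) ^+ 2)%:E <= (sigma ^+ 2)%:E)%E.
Proof.
move=> mX mz me e2 e1; have meX := L2_measurable e2.
have ie : (\int[P]_w (e (X w) ^+ 2)%:E = 1)%E.
  by under eq_integral do rewrite expr2; rewrite EFin_ip// e1.
move=> [[ind]|bnd].
  rewrite unlock => z2; apply: le_trans z2.
  pose F (z : R * XX) : \bar R := ((z.1 * e z.2) ^+ 2)%:E.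
  have mF : measurable_fun setT F.
    apply/measurable_EFinP; apply: measurable_funX; apply: measurable_funM => //.
    exact: measurableT_comp.
  rewrite (ge0_integral_independent2 (F := F) mz mX ind)//; last first.
    by move=> z; rewrite lee_fin sqr_ge0.
  under eq_integral => w _.
    rewrite /F/=; under eq_integral do rewrite exprMn EFinM.
    rewrite ge0_integralZl ?lee_fin ?sqr_ge0//; last 2 first.
    - by apply/measurable_EFinP; exact: measurable_funX.
    - by move=> v _; rewrite lee_fin sqr_ge0.
    rewrite ie mule1.
  over.
  by [].
apply: (@le_trans _ _ (\int[P]_w ((sigma ^+ 2)%:E * (e (X w) ^+ 2)%:E))%E).
  apply: ae_ge0_le_integral => //.
  - by move=> w _; rewrite lee_fin sqr_ge0.
  - by apply/measurable_EFinP; apply: measurable_funX; exact: measurable_funM.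
  - by move=> w _; rewrite lee_fin mulr_ge0// sqr_ge0.
  - by apply: measurable_funeM; apply/measurable_EFinP; exact: measurable_funX.
  - apply: filterS bnd => w zs _; rewrite -EFinM lee_fin exprMn.
    rewrite ler_wpM2r ?sqr_ge0// -real_normK ?num_real// ler_sqr ?nnegrE//.
    exact: le_trans zs.
rewrite ge0_integralZl ?lee_fin ?sqr_ge0//; last 2 first.
- by apply/measurable_EFinP; exact: measurable_funX.
- by move=> v _; rewrite lee_fin sqr_ge0.
by rewrite ie mule1.
Qed.

End OrthonormalSystem.

(** * Empirical risk minimization over the span *)

Theorem theoremA (R : realType)
    (d : measure_display) (T : measurableType d) (P : probability T R)
    (dX : measure_display) (XX : measurableType dX)
    (X : {RV P >-> XX}) (Y : {RV P >-> R})
    (N : nat) (Xs : 'I_N -> {RV P >-> XX}) (Ys : 'I_N -> {RV P >-> R})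
    (M : nat) (f : 'I_M -> XX -> R)
    (fstar : XX -> R) (fhat : T -> XX -> R)
    (kappa0 beta0 sigma : R) :
  (* the data *)
  ('E_P[fun w => (Y w ^+ 2)%R] < +oo)%E ->
  iid_copies P (fun i w => (Xs i w, Ys i w)) (fun w => (X w, Y w)) ->
  (* the dictionary *)
  (forall j, measurable_fun setT (f j)) ->
  (forall j, ('E_P[fun w => (f j (X w) ^+ 2)%R] < +oo)%E) ->
  (* the oracle *)
  lin_span f fstar ->
  risk P X Y fstar = inf [set risk P X Y h | h in lin_span f] ->
  (* the small-ball condition *)
  0 < kappa0 -> 0 < beta0 ->
  (forall h, lin_span f h ->
    (beta0%:E <= P [set w | kappa0 * L2norm P X h <= `|h (X w)|]%R)%E) ->
  400 ^+ 2 * M%:R / beta0 ^+ 2 <= N%:R ->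
  (* the noise *)
  (let zeta := fun w => Y w - fstar (X w) in
    (independent2 P zeta X /\ ('E_P[fun w => (zeta w ^+ 2)%R] <= (sigma ^+ 2)%:E)%E)
    \/ {ae P, forall w, `|zeta w| <= sigma}) ->
  (* empirical risk minimization *)
  (forall w, is_argmin (lin_span f)
    (emp_risk (fun i => Xs i) (fun i => Ys i) w) (fhat w)) ->
  forall x : R, 0 < x ->
    with_prob_ge P (1 - expR (- (beta0 ^+ 2 * N%:R / 4)) - 1 / x)
      [set w |
        L2norm P X (fun u => fhat w u - fstar u) ^+ 2
          = risk P X Y (fhat w) - inf [set risk P X Y h | h in lin_span f]
        /\ L2norm P X (fun u => fhat w u - fstar u) ^+ 2
          <= (16 / (beta0 * kappa0 ^+ 2)) ^+ 2 * (sigma ^+ 2 * M%:R * x / N%:R)].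
Proof.
move=> EY iid mf Ef fs oracle kappa0_gt0 beta0_gt0 small_ball Nbig noise erm x x0.
have Y2 : (Y : T -> R) \in Lfun P 2%:E.
  by apply: mem_L2 => //; exact: measurable_funPT.
have f2 j : (fun w => f j (X w)) \in Lfun P 2%:E.
  by apply: mem_L2; [exact: measurableT_comp|exact: Ef].
have span2 h : lin_span f h -> (fun w => h (X w)) \in Lfun P 2%:E.
  exact: lin_span_L2.
pose zeta w := Y w - fstar (X w).
have zeta2 : zeta \in Lfun P 2%:E by exact: (residual_L2 Y2 f2 fs).
have fhs w : lin_span f (fun u => fhat w u - fstar u).
  by apply: lin_spanB => //; have [] := erm w.
have excess w := excess_risk Y2 f2 fs oracle (proj1 (erm w)).
have [m [e [D [mM fe eo [mD PD] fb]]]] := gram_schmidt mf f2.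
have me k : measurable_fun setT (e k) by exact: lin_span_measurable.
have e2 k : (fun w => e k (X w)) \in Lfun P 2%:E by exact: span2.
have norm_coord h (b : 'cV[R]_m) : lin_span f h ->
    (forall u, ~ D u -> h u = \sum_(k < m) b k 0 * e k u) ->
    L2norm P X h ^+ 2 = dot b b.
  move=> fh hb; rewrite L2norm_sq -(ip_orthonormal b e2 eo).
  apply: (eq_ip_off_null (D := X @^-1` D)) => //.
  - exact: L2_measurable (span2 _ fh).
  - exact: L2_measurable (L2_sum (fun k => b k 0) e2).
  - exact: measurable_funPTI.
  - by move=> w Dw; exact: hb.
pose q := sigma ^+ 2 * M%:R / N%:R.
have q0 : 0 <= q by rewrite mulr_ge0 ?invr_ge0// mulr_ge0 ?sqr_ge0.
have rhsE : (16 / (beta0 * kappa0 ^+ 2)) ^+ 2 * (sigma ^+ 2 * M%:R * x / N%:R)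
    = (16 / (beta0 * kappa0 ^+ 2)) ^+ 2 * (q * x).
  by rewrite /q; congr (_ * _); rewrite mulrAC.
rewrite rhsE.
(* the span is null in L2; for an empty dictionary, the sample may be empty *)
have [m0|m_gt0] := posnP m.
  exists setT; split => //.
  - move=> w _; split => //.
    have [b hb] := fb _ (fhs w); rewrite (norm_coord _ b (fhs w) hb).
    rewrite /dot big1 => [|k _]; first by rewrite mulr_ge0 ?sqr_ge0// mulr_ge0// ltW.
    by have := ltn_ord k; rewrite {2}m0.
  - rewrite probability_setT lee_fin.
    have := expR_ge0 (- (beta0 ^+ 2 * N%:R / 4)).
    have : 0 <= 1 / x by rewrite divr_ge0// ltW.
    lra.
have N_gt0 : (0 < N)%N.
  rewrite lt0n; apply/eqP => N0; move: Nbig; rewrite N0 leNgt => /negP; apply.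
  apply: (divr_gt0 (mulr_gt0 (exprn_gt0 _ (ltr0Sn _ _)) _) (exprn_gt0 _ beta0_gt0)).
  by rewrite ltr0n; exact: leq_trans mM.
pose V u : 'cV[R]_m := \col_k e k u.
have dotV (t : 'cV[R]_m) u : dot t (V u) = \sum_(k < m) t k 0 * e k u.
  by apply: eq_bigr => k _; rewrite mxE.
have mV : measurable_mx V.
  by move=> k l; under eq_fun do rewrite mxE; exact: me.
have [indZ sameZ] := iid.
have indX : mutually_independent P (fun i => Xs i : T -> XX).
  exact: (mutually_independent_comp (@measurable_fst _ _ XX R) indZ).
have sameX i : same_distribution P (Xs i : T -> XX) X.
  exact: (same_distribution_comp (@measurable_fst _ _ XX R) (sameZ i)).
have beta1 : beta0 <= 1.
  rewrite -lee_fin; apply: le_trans (small_ball _ fs) _; apply: probability_le1.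
  rewrite -[X in measurable X]setTI; apply: measurable_fun_le => //.
  by apply: measurableT_comp => //; exact: L2_measurable (span2 _ fs).
have c0 : 0 < kappa0 ^+ 2 by rewrite exprn_gt0.
have small_ball_coord i (t : 'cV[R]_m) :
    (beta0%:E <= P [set w | (kappa0 ^+ 2 * dot t t <= dot t (V (Xs i w)) ^+ 2)%R])%E.
  pose B := [set u | kappa0 ^+ 2 * dot t t <= dot t (V u) ^+ 2].
  have mB : measurable B.
    rewrite -[B]setTI; apply: measurable_fun_le => //.
    apply: measurable_funX; apply: measurable_dot => [k l|]; last exact: mV.
    exact: measurable_cst.
  have ft : lin_span f (fun u => dot t (V u)).
    by under eq_fun do rewrite dotV; exact: lin_span_sum.
  rewrite [X in P X](_ : _ = Xs i @^-1` B)// sameX//.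
  apply: (le_trans (small_ball _ ft)); rewrite (_ : [set w | _] = X @^-1` B)//.
  have LN : L2norm P X (fun u => dot t (V u)) ^+ 2 = dot t t.
    by apply: norm_coord => // u _; exact: dotV.
  have sqE w : (kappa0 ^+ 2 * dot t t <= dot t (V (X w)) ^+ 2) =
      (kappa0 * L2norm P X (fun u => dot t (V u)) <= `|dot t (V (X w))|).
    rewrite -LN -exprMn -[in LHS](real_normK (num_real (dot t (V (X w))))).
    by rewrite ler_sqr ?nnegrE// mulr_ge0 ?sqrtr_ge0// ltW.
  by apply/seteqP; split => w; rewrite /B /= sqE.
have mXs i : measurable_fun setT (Xs i : T -> XX) by exact: measurable_funPT.
have b01 : 0 < beta0 <= 1 by rewrite beta0_gt0.
have expo := @union_bound_exponent R beta0 N%:R M%:R m%:R b01.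
have [|A1 [mA1 PA1 many_hits]] := uniform_small_ball mXs indX mV b01 c0 small_ball_coord.
  by apply: expo => //; rewrite ler1n ler_nat m_gt0.
pose psi k (z : XX * R) := (z.2 - fstar z.1) * e k z.1.
have mpsi k : measurable_fun setT (psi k).
  apply: measurable_funM; last exact: measurableT_comp.
  apply: measurable_funB => //; apply: measurableT_comp => //.
  exact: lin_span_measurable fs.
pose W k w := N%:R^-1 * \sum_(i < N) psi k (Xs i w, Ys i w).
have W2 k : W k \in Lfun P 2%:E /\ ip P (W k) (W k) <= sigma ^+ 2 / N%:R.
  have psi_sq : (\int[P]_w (psi k (X w, Y w) ^+ 2)%:E <= (sigma ^+ 2)%:E)%E.
    apply: (noise_moment (X := X) (zeta := zeta) (e := e k)) => //.
    - exact: L2_measurable zeta2.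
    - by rewrite eo eqxx.
  have psi2 : (fun w => psi k (X w, Y w)) \in Lfun P 2%:E.
    apply: mem_L2; first by apply: measurableT_comp => //; exact: measurable_fun_pair.
    by rewrite unlock (le_lt_trans psi_sq) ?ltry.
  apply: (@iid_mean_square _ _ _ P _ _ N _ _ (psi k) (sigma ^+ 2) _ _ iid) => //.
  - by move=> i; exact: measurable_fun_pair.
  - exact: measurable_fun_pair.
  - apply: (etrans (EFin_ip zeta2 (e2 k))).
    by rewrite (residual_orthogonal Y2 f2 fs oracle (fe k)).
  - by rewrite -lee_fin -EFin_ip//; under eq_integral do rewrite -expr2.
pose V2 w := \sum_(k < m) W k w * W k w.
have [|||mA2 PA2] := @markov_gt _ _ _ P V2 q x x0.
- by apply: measurable_sum => k; apply: measurable_funM; exact: L2_measurable (W2 k).1.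
- by move=> w; apply: sumr_ge0 => k _; rewrite -expr2 sqr_ge0.
- under eq_integral do rewrite -sumEFin.
  rewrite ge0_integral_sum//; last 2 first.
  + move=> k; apply/measurable_EFinP.
    by apply: measurable_funM; exact: L2_measurable (W2 k).1.
  + by move=> k w _; rewrite lee_fin -expr2 sqr_ge0.
  under eq_bigr => k _ do rewrite (EFin_ip (W2 k).1 (W2 k).1).
  rewrite sumEFin lee_fin.
  apply: (@le_trans _ _ (\sum_(k < m) sigma ^+ 2 / N%:R)).
    by apply: ler_sum => k _; exact: (W2 k).2.
  rewrite sumr_const card_ord -[_ *+ m]mulr_natr /q mulrAC.
  by rewrite ler_wpM2r ?invr_ge0// ler_wpM2l ?sqr_ge0// ler_nat.
set A2 := [set w | _] in mA2 PA2.
pose A3 := \big[setU/set0]_(i in [set: 'I_N]%SET) Xs i @^-1` D.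
have [|mA3 PA3] := @union_bound _ _ _ P _ [set: 'I_N]%SET (fun i => Xs i @^-1` D) 0.
  move=> i _; split; first exact: measurable_funPTI.
  by rewrite sameX// PD.
(* few hits, large noise, or a sample point in the null set *)
exists (~` (A1 `|` (A2 `|` A3))); split.
- by apply: measurableC; apply: measurableU => //; exact: measurableU.
- move=> w /not_orP[A1w /not_orP[A2w A3w]]; split => //.
  have offD i : ~ D (Xs i w).
    by move=> Dw; apply: A3w; rewrite /A3 (bigD1 i) ?inE//=; left.
  have [t ht] := fb _ (fhs w); rewrite (norm_coord _ t (fhs w) ht).
  have [->|t0] := eqVneq t 0.
    rewrite /dot big1 => [|k _]; first by rewrite mulr_ge0 ?sqr_ge0// mulr_ge0// ltW.
    by rewrite mxE mul0r.
  pose Wv : 'cV[R]_m := \col_k W k w.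
  apply: (@le_trans _ _ ((16 / (beta0 * kappa0 ^+ 2)) ^+ 2 * dot Wv Wv)).
    apply: (@erm_dot_bound _ _ N (fun i => Ys i w - fstar (Xs i w))
      (fun i => V (Xs i w))) => //.
    + apply/colP => k; rewrite !mxE summxE /W; congr (_ * _).
      by apply: eq_bigr => i _; rewrite !mxE.
    + have := (erm w).2 _ fs; rewrite /emp_risk ler_pM2l ?invr_gt0 ?ltr0n//.
      apply: le_trans; apply: ler_sum => i _; rewrite dotV -(ht _ (offD i)).
      by rewrite le_eqVlt; apply/orP; left; apply/eqP; congr (_ ^+ 2); ring.
    + exact: many_hits.
  rewrite ler_wpM2l ?sqr_ge0//.
  have -> : dot Wv Wv = V2 w by apply: eq_bigr => k _; rewrite !mxE.
  by rewrite leNgt; apply/negP.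
- rewrite probability_setC; last first.
    by apply: measurableU => //; exact: measurableU.
  have PU : (P (A1 `|` (A2 `|` A3)) <=
      (expR (- (beta0 ^+ 2 * N%:R / 4)) + 1 / x)%:E)%E.
    apply: (le_trans (measureU2 _ mA1 (measurableU _ _ mA2 mA3))).
    rewrite EFinD leeD//; apply: (le_trans (measureU2 _ mA2 mA3)).
    by rewrite -[leRHS]adde0 leeD//; move: PA3; rewrite mulr0.
  have PUfin : P (A1 `|` (A2 `|` A3)) \is a fin_num.
    by apply: fin_num_measure; apply: measurableU => //; exact: measurableU.
  rewrite -(fineK PUfin) -EFinB lee_fin.
  by move: PU; rewrite -(fineK PUfin) lee_fin; lra.
Qed.
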